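(* Assume $0$ belongs to a nonlinearity interval. Let $\mu>0$, let $(X^\mu,y^\mu,S^\mu)$ be the central solution at $\epsilon=0$, and let $\epsilon$ belong to this nonlinearity interval, in a neighborhood of $0$, such that $$\mu<\min\{\tilde\mu,\tilde\mu(\epsilon)\},$$ $$\|\Xi_X^\mu(\epsilon)\|\le\frac{\lambda_{[n_{\mathcal B}]}(X^\mu)-\lambda_{[n_{\mathcal B}+1]}(X^\mu)}5,\qquad \|\Xi_S^\mu(\epsilon)\|\le\frac{\lambda_{[n_{\mathcal N}]}(S^\mu)-\lambda_{[n_{\mathcal N}+1]}(S^\mu)}5 .$$ Then there exist $V^\mu_\epsilon\in\mathbb R^{(n-n_{\mathcal B})\times n_{\mathcal B}}$ and $W^\mu_\epsilon\in\mathbb R^{(n-n_{\mathcal N})\times n_{\mathcal N}}$ such that the columns of $$\big(Q^\mu_{\mathcal B}+Q^\mu_{\mathcal T\cup\mathcal N}V^\mu_\epsilon\big)\big(I_{n_{\mathcal B}}+(V^\mu_\epsilon)^TV^\mu_\epsilon\big)^{-1/2}\quad\text{and}\quad \big(Q^\mu_{\mathcal N}+Q^\mu_{\mathcal B\cup\mathcal T}W^\mu_\epsilon\big)\big(I_{n_{\mathcal N}}+(W^\mu_\epsilon)^TW^\mu_\epsilon\big)^{-1/2}$$ form orthonormal bases of $\mathcal R(Q^\mu_{\mathcal B(\epsilon)})$ and $\mathcal R(Q^\mu_{\mathcal N(\epsilon)})$, respectively. Furthermore, $$\operatorname{dist}\big(\mathcal R(Q^\mu_{\mathcal B}),\mathcal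 R(Q^\mu_{\mathcal B(\epsilon)})\big)\le\frac{4\|(Q^\mu_{\mathcal B})^T\Xi^\mu_X(\epsilon)Q^\mu_{\mathcal T\cup\mathcal N}\|}{\lambda_{[n_{\mathcal B}]}(X^\mu)-\lambda_{[n_{\mathcal B}+1]}(X^\mu)},$$ $$\operatorname{dist}\big(\mathcal R(Q^\mu_{\mathcal N}),\mathcal R(Q^\mu_{\mathcal N(\epsilon)})\big)\le\frac{4\|(Q^\mu_{\mathcal N})^T\Xi^\mu_S(\epsilon)Q^\mu_{\mathcal B\cup\mathcal T}\|}{\lambda_{[n_{\mathcal N}]}(S^\mu)-\lambda_{[n_{\mathcal N}+1]}(S^\mu)}.$$
   Context: Setting. $\mathbb S^n$ is the space of real symmetric $n\times n$ matrices with inner product $\langle C,X\rangle=\operatorname{trace}(CX)$; $\mathbb S^n_+$ is the cone of positive semidefinite matrices; $X\succeq0$ ($\succ0$) means positive semidefinite (definite). Given $C,\bar C,A^1,\dots,A^m\in\mathbb S^n$ and $b\in\mathbb R^m$, consider for $\epsilon\in\mathbb R$ $$(\mathrm P_\epsilon)\ \min\{\langle C+\epsilon\bar C,X\rangle : \langle A^i,X\rangle=b_i,\ i=1,\dots,m,\ X\succeq0\},$$ $$(\mathrm D_\epsilon)\ \max\{b^Ty : \textstyle\sum_i y_iA^i+S=C+\epsilon\bar C,\ S\succeq0,\ y\in\mathbb R^m\}.$$ Standing assumptions: $A^1,\dots,A^m$ are linearly independent, and at $\epsilon=0$ there is a feasible $(X,y,S)$ of $(\mathrm P_0),(\mathrm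 D_0)$ with $X\succ0$, $S\succ0$. $v(\epsilon)$ is the optimal value of $(\mathrm P_\epsilon)$ and $\mathcal E=\{\epsilon: v(\epsilon)>-\infty\}$, a closed interval with $0$ in its interior. For $\epsilon\in\operatorname{int}(\mathcal E)$ strong duality holds and the sets of optimal solutions $\mathcal P^*(\epsilon)$ (of $X$) and $\mathcal D^*(\epsilon)$ (of $(y,S)$) are nonempty and compact. An optimal solution $(X,y,S)$ is maximally complementary if $X\in\operatorname{ri}(\mathcal P^*(\epsilon))$ and $(y,S)\in\operatorname{ri}(\mathcal D^*(\epsilon))$. Optimal partition: for a maximally complementary solution $(X^*(\epsilon),y^*(\epsilon),S^*(\epsilon))$, $\mathcal B(\epsilon)$ is the column space of $X^*(\epsilon)$, $\mathcal N(\epsilon)$ the column space of $S^*(\epsilon)$, $\mathcal T(\epsilon)=(\mathcal B(\epsilon)+\mathcal N(\epsilon))^\perp$, $\pi(\epsilon)=(\mathcal B(\epsilon),\mathcal T(\epsilon),\mathcal N(\epsilon))$. A nonlinearity interval is a non-singleton open, possibly unbounded, subinterval of $\operatorname{int}(\mathcal E)$ of maximal length on which $\dim\mathcal B(\epsilon)$ and $\dim\mathcal N(\epsilon)$ are constant while $\pi(\epsilon)$ varies with $\epsilon$ (is not constant). The argument $\epsilon$ is dropped when $\epsilon=0$; $n_{\mathcal B},n_{\mathcal T},n_{\mathcal N}$ are the dimensions of $\mathcal B,\mathcal T,\mathcal N$ (the same for all $\epsilon$ in the nonlinearity interval containing $0$, and there $1\le n_{\mathcal B},n_{\mathcal N}\le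 n-1$). Notation: $\lambda_{[i]}(X)$ is the $i$-th largest eigenvalue; $\|\cdot\|$ is the Frobenius norm; $\|\cdot\|_2$ the Euclidean/spectral norm; $\mathcal R(\cdot)$ the column space; for subspaces of equal dimension $\operatorname{dist}(\mathcal S_1,\mathcal S_2)=\|\mathrm{Proj}_{\mathcal S_1}-\mathrm{Proj}_{\mathcal S_2}\|_2$ with orthogonal projections. Central solutions: for $\mu>0$, $(X^\mu(\epsilon),y^\mu(\epsilon),S^\mu(\epsilon))$ is the unique solution of $\langle A^i,X\rangle=b_i$ ($i=1,\dots,m$), $\sum_iy_iA^i+S=C+\epsilon\bar C$, $XS=\mu I_n$, $X,S\succeq0$. $\Xi^\mu_X(\epsilon)=X^\mu(\epsilon)-X^\mu$, $\Xi^\mu_S(\epsilon)=S^\mu(\epsilon)-S^\mu$. $X^\mu(\epsilon)$ and $S^\mu(\epsilon)$ have a common orthonormal eigenvector basis; its columns are arranged as $Q^\mu_\epsilon=(Q^\mu_{\mathcal B(\epsilon)},Q^\mu_{\mathcal T(\epsilon)},Q^\mu_{\mathcal N(\epsilon)})$, where $Q^\mu_{\mathcal B(\epsilon)}$ consists of eigenvectors for the $n_{\mathcal B}$ largest eigenvalues of $X^\mu(\epsilon)$, $Q^\mu_{\mathcal N(\epsilon)}$ of eigenvectors for the $n_{\mathcal N}$ largest eigenvalues of $S^\mu(\epsilon)$ (equivalently the $n_{\mathcal N}$ smallest of $X^\mu(\epsilon)$), and $Q^\mu_{\mathcal T(\epsilon)}$ of the remaining ones. At $\epsilon=0$ these are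 $Q^\mu_{\mathcal B},Q^\mu_{\mathcal T},Q^\mu_{\mathcal N}$, and $Q^\mu_{\mathcal T\cup\mathcal N}=(Q^\mu_{\mathcal T},Q^\mu_{\mathcal N})$, $Q^\mu_{\mathcal B\cup\mathcal T}=(Q^\mu_{\mathcal B},Q^\mu_{\mathcal T})$. Threshold $\tilde\mu$ (at $\epsilon=0$): let $Q_{\mathcal B},Q_{\mathcal N}$ have columns forming orthonormal bases of $\mathcal B,\mathcal N$. Put $\sigma_{\mathcal B}=\max_{X\in\mathcal P^*}\lambda_{\min}(Q_{\mathcal B}^TXQ_{\mathcal B})$ ($=\infty$ if $\mathcal B=\{0\}$), $\sigma_{\mathcal N}=\max_{(y,S)\in\mathcal D^*}\lambda_{\min}(Q_{\mathcal N}^TSQ_{\mathcal N})$ ($=\infty$ if $\mathcal N=\{0\}$), $\sigma=\min\{\sigma_{\mathcal B},\sigma_{\mathcal N}\}$. Let $\operatorname{svec}:\mathbb S^n\to\mathbb R^{n(n+1)/2}$ stack the upper triangle with off-diagonal entries multiplied by $\sqrt2$, $\mathcal A=(\operatorname{svec}(A^1),\dots,\operatorname{svec}(A^m))^T$, fix an optimal solution $(\check X,\check y,\check S)$, and let $\bar{\mathcal L}_{\mathcal P}=\{x\in\operatorname{svec}(\check X)+\operatorname{Null}(\mathcal A):\operatorname{svec}(\check S)^Tx=0\}$, $\bar{\mathcal L}_{\mathcal D}=\{s\in\operatorname{svec}(\check S)+\mathcal R(\mathcal A^T):\operatorname{svec}(\check X)^Ts=0\}$. Let $\theta_1,\theta_2>0$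 be fixed constants, independent of $\mu$, such that the Euclidean distances of $\operatorname{svec}(X^\mu)$ from $\bar{\mathcal L}_{\mathcal P}$ and of $\operatorname{svec}(S^\mu)$ from $\bar{\mathcal L}_{\mathcal D}$ are at most $\theta_1n\mu$ and $\theta_2n\mu$, respectively; put $\hat\mu=\frac1n\min\{\theta_1^{-1},\theta_2^{-1}\}$. Let $c>0$ and $\gamma\ge2^{1-n}$ be fixed constants, independent of $\mu$, such that for all $0<\mu\le\hat\mu$ the Frobenius distances of $X^\mu$ from $\operatorname{svec}^{-1}(\bar{\mathcal L}_{\mathcal P})\cap\mathbb S^n_+$ and of $S^\mu$ from $\operatorname{svec}^{-1}(\bar{\mathcal L}_{\mathcal D})\cap\mathbb S^n_+$ are at most $c(n\mu)^\gamma$ (such constants exist). Then $$\tilde\mu=\min\Big\{\frac1n\Big(\frac{\sigma}{cn^{3/2}}\Big)^{1/\gamma},\ \frac{\sigma^2}{n^2},\ \hat\mu\Big\}.$$ $\tilde\mu(\epsilon)$ is the analogous quantity for the problem pair $(\mathrm P_\epsilon),(\mathrm D_\epsilon)$. *)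

(* Defs.v *)
From mathcomp Require Import all_boot all_order all_algebra.
From mathcomp Require Import all_classical all_reals all_analysis.

Set Implicit Arguments.
Unset Strict Implicit.
Unset Printing Implicit Defensive.

Import Order.TTheory GRing.Theory Num.Theory.
Import numFieldNormedType.Exports.

Local Open Scope classical_set_scope.
Local Open Scope ring_scope.

Section LinearAlgebra.
Variable R : realType.

Definition inner n (C X : 'M[R]_n) : R := \tr (C *m X).

(* Frobenius norm; on column vectors, the Euclidean norm. (The norm `|M| that
   the library puts on matrices is the maximum norm.) *)
Definition fnorm p q (M : 'M[R]_(p, q)) : R :=
  Num.sqrt (\sum_i \sum_j M i j ^+ 2).

Definition spectral_norm p q (M : 'M[R]_(p, q)) : R :=
  sup [set fnorm (M *m x) | x in [set x : 'cV[R]_q | fnorm x <= 1]].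

Definition setdist p q (x : 'M[R]_(p, q)) (L : set 'M[R]_(p, q)) : R :=
  inf [set fnorm (x - z) | z in L].

Definition psd n (X : 'M[R]_n) : Prop :=
  X^T = X /\ forall x : 'cV[R]_n, 0 <= (x^T *m X *m x) 0 0.

Definition posdef n (X : 'M[R]_n) : Prop :=
  X^T = X /\ forall x : 'cV[R]_n, x != 0 -> 0 < (x^T *m X *m x) 0 0.

(* The eigenvalues, repeated according to multiplicity, in nonincreasing order;
   the list exists and is unique as soon as M is symmetric. *)
Definition eigvals n (M : 'M[R]_n) : seq R :=
  xget [::] [set s | sorted >=%R s /\
                     char_poly M = \prod_(x <- s) ('X - x%:P)].

(* i counts from 1 *)
Definition lambda n (i : nat) (M : 'M[R]_n) : R := nth 0 (eigvals M) i.-1.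

Definition lambda_min n (M : 'M[R]_n) : R := lambda n M.

(* The unique positive semidefinite square root, for M positive semidefinite. *)
Definition sqrtmx n (M : 'M[R]_n) : 'M[R]_n :=
  xget 0 [set Z | psd Z /\ Z *m Z = M].

Definition invsqrtmx n (M : 'M[R]_n) : 'M[R]_n := invmx (sqrtmx M).

(* A subspace of R^n is represented by the square matrix <<U>>%MS canonically
   attached to a matrix U whose rows span it, so that equality of subspaces is
   equality of matrices and the dimension is the rank. *)
Definition colspace n k (M : 'M[R]_(n, k)) : 'M[R]_n := << M^T >>%MS.

Definition orthcompl n (U : 'M[R]_n) : 'M[R]_n := << kermx U^T >>%MS.

Definition orthproj n (U : 'M[R]_n) : 'M[R]_n := proj_mx U (orthcompl U).

Definition subspace_dist n (U V : 'M[R]_n) : R :=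
  spectral_norm (orthproj U - orthproj V).

Definition orthonormal_basis n k (Q : 'M[R]_(n, k)) (U : 'M[R]_n) : Prop :=
  Q^T *m Q = 1%:M /\ colspace Q = U.

(* svec lives in R^(n(n+1)/2), here indexed by the positions (i, j) with i <= j;
   see card_upper. *)
Definition upper n := [pred ij : 'I_n * 'I_n | (ij.1 <= ij.2)%N].

Definition svec n (X : 'M[R]_n) : 'cV[R]_#|upper n| :=
  \col_k let ij := enum_val k in
         if ij.1 == ij.2 then X ij.1 ij.2 else Num.sqrt 2 * X ij.1 ij.2.

Definition affine_hull (V : lmodType R) (K : set V) : set V :=
  [set z | exists k (p : 'I_k -> V) (a : 'I_k -> R),
     [/\ forall i, K (p i), \sum_i a i = 1 & z = \sum_i a i *: p i]].

Definition relint (V : normedModType R) (K : set V) : set V :=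
  [set x | K x /\ \forall z \near x, affine_hull K z -> K z].

End LinearAlgebra.

Lemma card_upper n : #|upper n| = 'C(n.+1, 2).
Proof.
have -> : #|upper n| = (\sum_(j < n) j.+1)%N.
  rewrite -sum1_card (eq_bigl (fun ij : 'I_n * 'I_n => (ij.1 <= ij.2)%N)) //.
  rewrite (eq_bigl (fun ij : 'I_n * 'I_n => xpredT ij.1 && (ij.1 <= ij.2)%N)) //.
  rewrite -(pair_big_dep xpredT (fun i j : 'I_n => (i <= j)%N) (fun _ _ => 1%N)) /=.
  rewrite (exchange_big_dep xpredT) //=; apply: eq_bigr => j _.
  rewrite (eq_bigl (fun i : 'I_n => (i < j.+1)%N)) //.
  by rewrite -(big_ord_widen _ (fun=> 1%N) (ltn_ord j)) sum1_card card_ord.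
by rewrite -bin2_sum big_mkord big_ord_recl add0n.
Qed.

Record sdp (R : realType) (n m : nat) := Sdp {
  costC : 'M[R]_n;
  costCbar : 'M[R]_n;
  conA : 'I_m -> 'M[R]_n;
  conb : 'cV[R]_m
}.

Section ParametricSdp.
Variables (R : realType) (n m : nat) (D : sdp R n m).
Implicit Types (eps mu : R) (X S : 'M[R]_n) (y : 'cV[R]_m).

Definition cost eps : 'M[R]_n := costC D + eps *: costCbar D.

Definition primal_feasible eps X : Prop :=
  psd X /\ forall i, inner (conA D i) X = conb D i 0.

Definition dual_feasible eps y S : Prop :=
  psd S /\ \sum_i y i 0 *: conA D i + S = cost eps.

Definition dual_obj y : R := \sum_i conb D i 0 * y i 0.

Definition standing_assumptions : Prop :=
  [/\ (costC D)^T = costC D, (costCbar D)^T = costCbar D,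
      forall i, (conA D i)^T = conA D i,
      free [tuple conA D i | i < m]
    & exists X y S, [/\ primal_feasible 0 X, dual_feasible 0 y S,
                        posdef X & posdef S]].

Definition optval eps : \bar R :=
  ereal_inf [set (inner (cost eps) X)%:E | X in primal_feasible eps].

Definition optdom : set R := [set eps | (-oo < optval eps)%E].

Definition primal_opt eps : set 'M[R]_n :=
  [set X | primal_feasible eps X /\
     forall X', primal_feasible eps X' ->
       inner (cost eps) X <= inner (cost eps) X'].

Definition dual_opt eps : set ('cV[R]_m * 'M[R]_n) :=
  [set z | dual_feasible eps z.1 z.2 /\
     forall y' S', dual_feasible eps y' S' -> dual_obj y' <= dual_obj z.1].

Definition max_compl eps : set ('M[R]_n * ('cV[R]_m * 'M[R]_n)) :=
  [set z | relint (primal_opt eps) z.1 /\ relint (dual_opt eps) z.2].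

(* An arbitrary maximally complementary solution: the subspaces below do not
   depend on which one is chosen. *)
Definition mc_sol eps : 'M[R]_n * ('cV[R]_m * 'M[R]_n) :=
  xget 0 (max_compl eps).

Definition spB eps : 'M[R]_n := colspace (mc_sol eps).1.

Definition spN eps : 'M[R]_n := colspace (mc_sol eps).2.2.

Definition spT eps : 'M[R]_n := orthcompl (spB eps + spN eps)%MS.

Definition opt_partition eps : 'M[R]_n * 'M[R]_n * 'M[R]_n :=
  (spB eps, spT eps, spN eps).

Definition fixed_dim_varying_partition (I : set R) : Prop :=
  [/\ open I /\ is_interval I,
      exists e1 e2, [/\ I e1, I e2 & e1 != e2],
      I `<=` interior optdom,
      forall e1 e2, I e1 -> I e2 ->
        \rank (spB e1) = \rank (spB e2) /\ \rank (spN e1) = \rank (spN e2)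
    & exists e1 e2, [/\ I e1, I e2 & opt_partition e1 <> opt_partition e2]].

Definition nonlinearity_interval (I : set R) : Prop :=
  fixed_dim_varying_partition I /\
  forall J, fixed_dim_varying_partition J -> I `<=` J -> J = I.

Definition central mu eps X y S : Prop :=
  [/\ forall i, inner (conA D i) X = conb D i 0,
      \sum_i y i 0 *: conA D i + S = cost eps,
      X *m S = mu%:M, psd X & psd S].

Definition svecA : 'M[R]_(m, #|upper n|) := \matrix_(i, k) svec (conA D i) k 0.

Definition LbarP (Xc Sc : 'M[R]_n) : set 'cV[R]_#|upper n| :=
  [set x | svecA *m (x - svec Xc) = 0 /\ (svec Sc)^T *m x = 0].

Definition LbarD (Xc Sc : 'M[R]_n) : set 'cV[R]_#|upper n| :=
  [set s | (exists y : 'cV[R]_m, s = svec Sc + svecA^T *m y) /\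
           (svec Xc)^T *m s = 0].

(* The maxima are over nonempty compact sets (for eps interior to optdom), hence
   equal to these suprema. *)
Definition sigmaB eps k (QB : 'M[R]_(n, k)) : \bar R :=
  if k == 0%N then +oo%E
  else ereal_sup [set (lambda_min (QB^T *m X *m QB))%:E | X in primal_opt eps].

Definition sigmaN eps k (QN : 'M[R]_(n, k)) : \bar R :=
  if k == 0%N then +oo%E
  else ereal_sup [set (lambda_min (QN^T *m z.2 *m QN))%:E | z in dual_opt eps].

Definition muhat (theta1 theta2 : R) : R :=
  n%:R^-1 * Num.min theta1^-1 theta2^-1.

Definition mutilde (sigma : \bar R) (theta1 theta2 c gamma : R) : \bar R :=
  mine (mine (((n%:R : R)^-1)%:E *
              ((sigma * ((c * n%:R `^ (3 / 2))^-1)%:E) `^ (gamma^-1)))%E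
             (sigma ^+ 2 * ((n%:R ^+ 2 : R)^-1)%:E)%E)
       (muhat theta1 theta2)%:E.

Definition linear_bounds eps (Xc Sc : 'M[R]_n) (theta1 theta2 : R) : Prop :=
  forall mu X y S, 0 < mu -> central mu eps X y S ->
    setdist (svec X) (LbarP Xc Sc) <= theta1 * n%:R * mu /\
    setdist (svec S) (LbarD Xc Sc) <= theta2 * n%:R * mu.

Definition holder_bounds eps (Xc Sc : 'M[R]_n) (theta1 theta2 c gamma : R) :
    Prop :=
  forall mu X y S, 0 < mu <= muhat theta1 theta2 -> central mu eps X y S ->
    setdist X [set Z | psd Z /\ LbarP Xc Sc (svec Z)]
      <= c * (n%:R * mu) `^ gamma /\
    setdist S [set Z | psd Z /\ LbarD Xc Sc (svec Z)]
      <= c * (n%:R * mu) `^ gamma.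

(* mt is the threshold obtained from some admissible choice of the bases, of the
   optimal solution (Xc, yc, Sc) and of the constants. *)
Definition is_mutilde eps (mt : \bar R) : Prop :=
  exists kB kN (QB : 'M[R]_(n, kB)) (QN : 'M[R]_(n, kN)) Xc yc Sc
         (theta1 theta2 c gamma : R),
  [/\ orthonormal_basis QB (spB eps) /\ orthonormal_basis QN (spN eps),
      primal_opt eps Xc /\ dual_opt eps (yc, Sc),
      [/\ 0 < theta1, 0 < theta2 & linear_bounds eps Xc Sc theta1 theta2],
      [/\ 0 < c, 2 `^ (1 - n%:R) <= gamma
        & holder_bounds eps Xc Sc theta1 theta2 c gamma]
    & mt = mutilde (mine (sigmaB eps QB) (sigmaN eps QN))
                   theta1 theta2 c gamma].

End ParametricSdp.

(* The columns of (QB, QT, QN) form an orthonormal basis of common eigenvectors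
   of X and S; those of QB belong to the largest eigenvalues of X and those of QN
   to the largest eigenvalues of S. The order inside each block is free. *)
Definition eigenbasis_blocks (R : realType) n nB nT nN (X S : 'M[R]_n)
    (QB : 'M[R]_(n, nB)) (QT : 'M[R]_(n, nT)) (QN : 'M[R]_(n, nN)) : Prop :=
  let Q := row_mx QB (row_mx QT QN) in
  [/\ Q^T *m Q = 1%:M, Q *m Q^T = 1%:M
    & exists (xB sB : 'rV[R]_nB) (xT sT : 'rV[R]_nT) (xN sN : 'rV[R]_nN),
      [/\ X *m Q = Q *m diag_mx (row_mx xB (row_mx xT xN)),
          S *m Q = Q *m diag_mx (row_mx sB (row_mx sT sN)),
          forall i j, row_mx xT xN 0 j <= xB 0 i
        & forall i j, row_mx sB sT 0 j <= sN 0 i]].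

(* Main.v *)
(* The gap lambda_[nB] - lambda_[nB+1] of X^mu is positive below the threshold.  If
   W is an optimal solution whose restriction to B is bounded below by sigma, then
   <W, S^mu> <= n mu forces the nB smallest eigenvalues of S^mu = mu (X^mu)^-1 to
   be at most n mu / sigma, so the nB largest eigenvalues of X^mu are at least
   sigma / n.  On the other hand X^mu is within c (n mu)^gamma of an optimal
   solution, whose range lies in B and hence has rank at most nB, so that
   lambda_[nB+1] is at most c (n mu)^gamma, which is smaller than sigma / n.  That
   the optimal face is nonempty in the form used here requires strong duality.

   Given the gap delta and the perturbation E with |E| <= delta / 5, let P be the
   leading eigenvectors of the perturbed matrix and Y = Q1^T P, Z = Q2^T P.  The
   eigenvalues of the perturbed matrix on P stay above lambda_[nB] - delta / 5, so
   the Sylvester equation for Z gives |Z| <= 1/4; hence Y is invertible and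
   V = Z Y^-1 works.  Splitting P = Q1 Y + Q2 Z on the right-hand side of the same
   equation gives |Z| <= 5 |Q1^T E Q2| / (3 delta), and the distance between the
   two eigenspaces is at most sqrt 2 |Z|. *)

Require Import Defs.
From mathcomp Require Import all_boot all_order all_algebra.
From mathcomp Require Import all_classical all_reals all_analysis.
From mathcomp Require Import ring lra.

Set Implicit Arguments.
Unset Strict Implicit.
Unset Printing Implicit Defensive.

Import Order.TTheory GRing.Theory Num.Theory.
Import numFieldNormedType.Exports.

Local Open Scope classical_set_scope.
Local Open Scope ring_scope.

(** * The Frobenius norm *)

Lemma Cauchy_Schwarz_sum (R : realType) (J : finType) (a b : J -> R) :
  (\sum_i a i * b i) ^+ 2 <= (\sum_i a i * a i) * (\sum_i b i * b i).
Proof.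
set d := \sum_i a i * b i; set A := \sum_i a i * a i; set c := \sum_i b i * b i.
have b_ge0 i : true -> 0 <= b i * b i by rewrite -expr2 sqr_ge0.
(* The vector [c * a - d * b] is [c] times the component of [a] orthogonal to [b]. *)
have key : \sum_i (c * a i - d * b i) ^+ 2 = c * (A * c - d ^+ 2).
  rewrite (eq_bigr (fun i => c ^+ 2 * (a i * a i) + d ^+ 2 * (b i * b i)
             - 2 * c * d * (a i * b i))); last by move=> i _; ring.
  by rewrite sumrB big_split /= -!mulr_sumr -/A -/c -/d; ring.
have [c_gt0|c_le0] := ltrP 0 c.
  rewrite -subr_ge0 -(pmulr_rge0 _ c_gt0) -key.
  by apply: sumr_ge0 => i _; exact: sqr_ge0.
have c0 : c = 0 by apply/eqP; rewrite eq_le c_le0 sumr_ge0.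
rewrite c0 mulr0 (_ : d = 0) ?expr0n// /d big1// => i _.
have /eqP : b i * b i = 0 by exact: (psumr_eq0P b_ge0 c0).
by rewrite mulf_eq0 orbb => /eqP->; rewrite mulr0.
Qed.

Lemma mxtrace_mulTmx (R : realType) p q (A B : 'M[R]_(p, q)) :
  \tr (A^T *m B) = \sum_i \sum_j A i j * B i j.
Proof.
rewrite exchange_big /=; apply: eq_bigr => j _; rewrite mxE.
by apply: eq_bigr => i _; rewrite mxE.
Qed.

Lemma fnorm_ge0 (R : realType) p q (A : 'M[R]_(p, q)) : 0 <= fnorm A.
Proof. exact: sqrtr_ge0. Qed.

Lemma fnorm_sqr (R : realType) p q (A : 'M[R]_(p, q)) :
  fnorm A ^+ 2 = \tr (A^T *m A).
Proof.
rewrite sqr_sqrtr ?mxtrace_mulTmx; last first.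
  by do 2!(apply: sumr_ge0 => ? _); exact: sqr_ge0.
by do 2!(apply: eq_bigr => ? _); rewrite expr2.
Qed.

Lemma fnorm_eq (R : realType) p q p' q' (A : 'M[R]_(p, q)) (B : 'M[R]_(p', q')) :
  \tr (A^T *m A) = \tr (B^T *m B) -> fnorm A = fnorm B.
Proof. by rewrite -!fnorm_sqr => /pexpIrn; apply; rewrite // nnegrE fnorm_ge0. Qed.

Lemma fnorm0 (R : realType) p q : fnorm (0 : 'M[R]_(p, q)) = 0.
Proof. by apply/eqP; rewrite -sqrf_eq0 fnorm_sqr mulmx0 mxtrace0. Qed.

Lemma fnorm_eq0 (R : realType) p q (A : 'M[R]_(p, q)) : fnorm A = 0 -> A = 0.
Proof.
move=> A0; apply/matrixP => i j; rewrite mxE; apply/eqP; rewrite -sqrf_eq0.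
have : \sum_i \sum_j A i j ^+ 2 = 0.
  have := fnorm_sqr A; rewrite A0 expr0n mxtrace_mulTmx /= => e; rewrite [RHS]e.
  by do 2!(apply: eq_bigr => ? _); rewrite expr2.
move=> s0; have {s0} := psumr_eq0P (fun i _ => sumr_ge0 _ (fun j _ => sqr_ge0 _)) s0.
by move=> /(_ i isT) /(psumr_eq0P (fun j _ => sqr_ge0 _)) /(_ j isT) ->.
Qed.

Lemma fnormT (R : realType) p q (A : 'M[R]_(p, q)) : fnorm A^T = fnorm A.
Proof. by apply: fnorm_eq; rewrite trmxK mxtrace_mulC. Qed.

Lemma Cauchy_Schwarz_fnorm (R : realType) p q (A B : 'M[R]_(p, q)) :
  `|\tr (A^T *m B)| <= fnorm A * fnorm B.
Proof.
rewrite -ler_sqr ?nnegrE ?mulr_ge0 ?fnorm_ge0//.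
rewrite real_normK ?num_real// exprMn !fnorm_sqr.
rewrite !mxtrace_mulTmx !pair_bigA /=.
exact: Cauchy_Schwarz_sum.
Qed.

Lemma ler_fnormD (R : realType) p q (A B : 'M[R]_(p, q)) :
  fnorm (A + B) <= fnorm A + fnorm B.
Proof.
rewrite -ler_sqr ?nnegrE ?addr_ge0 ?fnorm_ge0// sqrrD !fnorm_sqr.
rewrite [(A + B)^T]linearD /= mulmxDl !mulmxDr !mxtraceD.
have -> : \tr (B^T *m A) = \tr (A^T *m B).
  by rewrite -mxtrace_tr trmx_mul trmxK.
have := Cauchy_Schwarz_fnorm A B; have := ler_norm (\tr (A^T *m B)); lra.
Qed.

Lemma ler_fnormM (R : realType) p q r (A : 'M[R]_(p, q)) (B : 'M[R]_(q, r)) :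
  fnorm (A *m B) <= fnorm A * fnorm B.
Proof.
rewrite -ler_sqr ?nnegrE ?mulr_ge0 ?fnorm_ge0// exprMn !fnorm_sqr.
rewrite !mxtrace_mulTmx.
rewrite [X in _ <= _ * X]exchange_big /= big_distrl /=; apply: ler_sum => i _.
rewrite big_distrr /=; apply: ler_sum => j _; rewrite !mxE -expr2.
exact: Cauchy_Schwarz_sum.
Qed.

Lemma fnorm_mulQ (R : realType) p q r (Q : 'M[R]_(p, q)) (A : 'M[R]_(q, r)) :
  Q^T *m Q = 1%:M -> fnorm (Q *m A) = fnorm A.
Proof.
by move=> QQ; apply: fnorm_eq; rewrite trmx_mul -mulmxA (mulmxA Q^T) QQ mul1mx.
Qed.

Lemma le_entry_fnorm (R : realType) p q (A : 'M[R]_(p, q)) i j :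
  `|A i j| <= fnorm A.
Proof.
rewrite -ler_sqr ?nnegrE ?fnorm_ge0//.
rewrite real_normK ?num_real// fnorm_sqr mxtrace_mulTmx.
rewrite (bigD1 i)//= (bigD1 j)//= -expr2 -addrA lerDl addr_ge0//.
  by apply: sumr_ge0 => ? _; rewrite -expr2 sqr_ge0.
by do 2!(apply: sumr_ge0 => ? _); rewrite -expr2 sqr_ge0.
Qed.

Lemma fnorm_cV_sqr (R : realType) n (x : 'cV[R]_n) :
  fnorm x ^+ 2 = (x^T *m x) 0 0.
Proof. by rewrite fnorm_sqr /mxtrace big_ord1. Qed.

Lemma quad_le_fnorm (R : realType) n (E : 'M[R]_n) (x : 'cV[R]_n) :
  `|(x^T *m E *m x) 0 0| <= fnorm E * (x^T *m x) 0 0.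
Proof.
have -> : (x^T *m E *m x) 0 0 = \tr (x^T *m (E *m x)).
  by rewrite /mxtrace big_ord1 mulmxA.
apply: le_trans (Cauchy_Schwarz_fnorm _ _) _.
rewrite -fnorm_cV_sqr expr2 mulrCA ler_wpM2l ?fnorm_ge0//.
exact: ler_fnormM.
Qed.

(** * The spectral theorem *)

(** Lets the compactness of closed bounded sets of row vectors serve for matrices of any shape. *)
Lemma vec_mx_continuous (R : realType) p q :
  continuous (@vec_mx R p q).
Proof.
move=> v A [P /= Pv PA]; suff : nbhs v [set w | forall i j, P i j (vec_mx w i j)].
  by apply: filterS => w Pw; exact: PA.
exists (fun _ k => [set t | forall i j, mxvec_index i j = k -> P i j t]).
  move=> i0 k; rewrite (ord1 i0); case/mxvec_indexP: k => i j.
  have := Pv i j; rewrite mxE; apply: filterS => t Pt i' j'.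
  by move=> /(congr1 val)/= /val_inj /(can_inj (@enum_rankK _)) [-> ->].
by move=> w /= Pw i j; rewrite mxE; apply: (Pw 0).
Qed.

(** The Frobenius norm dominates every entry, so the vectorized set is bounded in the maximum norm
    and hence compact. *)
Lemma mx_compact_min (R : realType) p q (K : set 'M[R]_(p, q))
    (f : 'M[R]_(p, q) -> R) (b : R) :
  K !=set0 -> closed K -> (forall M, K M -> fnorm M <= b) -> continuous f ->
  exists2 M, K M & forall N, K N -> f M <= f N.
Proof.
move=> [M0 KM0] clK bK cf.
have cvx := @vec_mx_continuous R p q.
have cK : compact (vec_mx @^-1` K).
  apply: bounded_closed_compact; last by apply: closed_comp => // x _; exact: cvx.
  exists b; split => [|c bc v /= /bK vb]; first exact: num_real.
  have c_ge0 : 0 <= c by rewrite ltW// (le_lt_trans _ bc)// (le_trans _ vb)// fnorm_ge0.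
  rewrite -[leLHS]/(mx_norm v) mx_normrE; apply: bigmax_le => // -[i k] _ /=.
  rewrite (ord1 i) (le_trans _ (ltW bc))// (le_trans _ vb)//.
  case/mxvec_indexP: k => i' j'; have := le_entry_fnorm (vec_mx v) i' j'.
  by rewrite mxE.
have [|||c] := @compact_EVT_min _ R (f \o vec_mx) (vec_mx @^-1` K).
- by exists (mxvec M0) => /=; rewrite mxvecK.
- exact: cK.
- by apply: continuous_subspaceT => x; apply: continuous_comp; [exact: cvx|exact: cf].
rewrite inE /= => Kc cmin; exists (vec_mx c) => // N KN.
by have := cmin (mxvec N); rewrite inE /= mxvecK; apply.
Qed.

Lemma continuous_sum (R : realType) (T : topologicalType) (J : finType)
    (F : J -> T -> R) :
  (forall i, continuous (F i)) -> continuous (fun x => \sum_i F i x).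
Proof.
by move=> Fc; apply: continuous_big => //; exact: add_continuous.
Qed.

Lemma mxtrace_mul_continuous (R : realType) p q (A : 'M[R]_(q, p)) :
  continuous (fun X : 'M[R]_(p, q) => \tr (A *m X)).
Proof.
have -> : (fun X : 'M[R]_(p, q) => \tr (A *m X)) =
    (fun X : 'M[R]_(p, q) => \sum_i \sum_j A i j * X j i).
  by apply/funext => Z; apply: eq_bigr => i _; rewrite mxE.
apply: continuous_sum => i; apply: continuous_sum => j X.
by apply: continuousM; [exact: cst_continuous | exact: coord_continuous].
Qed.

Lemma quad_continuous (R : realType) n (M : 'M[R]_n) :
  continuous (fun x : 'cV[R]_n => (x^T *m M *m x) 0 0).
Proof.
have -> : (fun x : 'cV[R]_n => (x^T *m M *m x) 0 0) =
    (fun x : 'cV[R]_n => \sum_i \sum_j x j 0 * M j i * x i 0).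
  apply/funext => z; rewrite mxE; apply: eq_bigr => i _; rewrite mxE big_distrl /=.
  by apply: eq_bigr => j _; rewrite mxE.
apply: continuous_sum => i; apply: continuous_sum => j x.
have cl : {for x, continuous (fun z : 'cV[R]_n => z j 0 * M j i)}.
  by apply: continuousM; [exact: coord_continuous|exact: cst_continuous].
exact: continuousM cl (@coord_continuous _ _ _ i 0 x).
Qed.

Lemma quad_symC (R : realType) n (A : 'M[R]_n) (x y : 'cV[R]_n) : A^T = A ->
  (x^T *m A *m y) 0 0 = (y^T *m A *m x) 0 0.
Proof.
move=> As; transitivity ((y^T *m A *m x)^T 0 0); last by rewrite mxE.
by rewrite !trmx_mul trmxK As mulmxA.
Qed.

Lemma nonneg_quadratic_linear0 (R : realType) (a b : R) :
  (forall t, 0 <= t * (2 * a) + t ^+ 2 * b) -> a = 0.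
Proof.
move=> h; have b_ge0 : 0 <= b by have := h 1; have := h (-1); lra.
apply/eqP; rewrite -sqrf_eq0 eq_le sqr_ge0 andbT.
(* Close to the minimizer [- a / b]; the shift by 1 keeps the denominator positive when [b = 0]. *)
have := h (- a / (b + 1)).
have -> : - a / (b + 1) * (2 * a) + (- a / (b + 1)) ^+ 2 * b =
          - (a ^+ 2) * ((b + 2) / (b + 1) ^+ 2) by field; lra.
have pos : 0 < (b + 2) / (b + 1) ^+ 2 by rewrite divr_gt0// ?exprn_gt0//; lra.
by rewrite pmulr_lge0// oppr_ge0.
Qed.

Lemma quadD (R : realType) n (A : 'M[R]_n) (x y : 'cV[R]_n) t : A^T = A ->
  ((x + t *: y)^T *m A *m (x + t *: y)) 0 0 =
  (x^T *m A *m x) 0 0 + (t * (2 * (y^T *m A *m x) 0 0)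
    + t ^+ 2 * (y^T *m A *m y) 0 0).
Proof.
move=> As; rewrite [(x + _)^T]linearD /= [(t *: y)^T]linearZ /=.
rewrite !(mulmxDl, mulmxDr) -!(scalemxAl, scalemxAr).
rewrite !mxE -/((x^T *m A *m y) 0 0).
have := quad_symC x y As; rewrite !mxE => ->; ring.
Qed.

(** Moving from [x] in the direction [A x] changes the form by [2 t |A x|^2] to first order, while
    the form stays nonnegative for both signs of [t]. *)
Lemma psd_quad0 (R : realType) n (A : 'M[R]_n) (x : 'cV[R]_n) :
  psd A -> (x^T *m A *m x) 0 0 = 0 -> A *m x = 0.
Proof.
move=> [As Ap] x0; apply: fnorm_eq0; apply/eqP; rewrite -sqrf_eq0 fnorm_cV_sqr.
have -> : ((A *m x)^T *m (A *m x)) 0 0 = ((A *m x)^T *m A *m x) 0 0.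
  by rewrite mulmxA.
apply/eqP/(nonneg_quadratic_linear0 (b := ((A *m x)^T *m A *m (A *m x)) 0 0)).
by move=> t; have := Ap (x + t *: (A *m x)); rewrite quadD// x0 add0r.
Qed.

Lemma psd_congr (R : realType) n k (A : 'M[R]_n) (V : 'M[R]_(n, k)) :
  psd A -> psd (V^T *m A *m V).
Proof.
move=> [As Ap]; split; first by rewrite !trmx_mul trmxK As mulmxA.
by move=> x; have := Ap (V *m x); rewrite trmx_mul !mulmxA.
Qed.

Lemma psd_diag_ge0 (R : realType) n (A : 'M[R]_n) i : psd A -> 0 <= A i i.
Proof.
move=> [_ /(_ (delta_mx i 0))]; rewrite trmx_delta -rowE -colE.
by rewrite !mxE.
Qed.

Lemma psd_tr_ge0 (R : realType) n (A : 'M[R]_n) : psd A -> 0 <= \tr A.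
Proof. by move=> Ap; apply: sumr_ge0 => i _; exact: psd_diag_ge0. Qed.

Lemma sphere_closed (R : realType) n :
  closed [set x : 'cV[R]_n | (x^T *m x) 0 0 = 1].
Proof.
rewrite (_ : mkset _ = (fun x : 'cV[R]_n => (x^T *m 1%:M *m x) 0 0) @^-1` [set 1]).
  by apply: (continuous_closedP _).1; [exact: quad_continuous|exact: closed_eq].
by apply/seteqP; split => x /=; rewrite mulmx1.
Qed.

(** At a minimizer [x] of the Rayleigh quotient with value [c], the matrix [M - c I] is positive
    semidefinite and its form vanishes at [x], so it kills [x]. *)
Lemma sym_Rayleigh_min (R : realType) n (M : 'M[R]_n.+1) : M^T = M ->
  exists (x : 'cV[R]_n.+1) (c : R),
    (x^T *m x) 0 0 = 1 /\ M *m x = c *: x.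
Proof.
move=> Ms; pose K := [set x : 'cV[R]_n.+1 | (x^T *m x) 0 0 = 1].
have K0 : K !=set0.
  exists (delta_mx 0 0); rewrite /K /= trmx_delta mul_delta_mx mxE.
  by rewrite !eqxx.
have Kb x : K x -> fnorm x <= 1.
  by move=> Kx; rewrite -(@ler_pXn2r _ 2)// ?nnegrE ?fnorm_ge0// fnorm_cV_sqr Kx expr1n.
have [x Kx xmin] := mx_compact_min K0 (@sphere_closed R n.+1) Kb
  (@quad_continuous R n.+1 M).
exists x, ((x^T *m M *m x) 0 0); split => //.
set c := (x^T *m M *m x) 0 0.
suff : (M - c%:M) *m x = 0.
  by rewrite mulmxBl mul_scalar_mx => /eqP; rewrite subr_eq0 => /eqP.
have quadE (z : 'cV[R]_n.+1) : (z^T *m (M - c%:M) *m z) 0 0 =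
    (z^T *m M *m z) 0 0 - c * (z^T *m z) 0 0.
  by rewrite mulmxBr mulmxBl mul_mx_scalar -scalemxAl !mxE.
apply: psd_quad0; last by rewrite quadE -/c Kx mulr1 subrr.
split=> [|z]; first by rewrite linearB /= tr_scalar_mx Ms.
rewrite quadE subr_ge0.
have [z0|z_neq0] := eqVneq ((z^T *m z) 0 0) 0.
  have -> : z = 0.
    by apply: fnorm_eq0; apply/eqP; rewrite -sqrf_eq0 fnorm_cV_sqr z0.
  by rewrite !mulmx0 !mxE mulr0.
have zz : (z^T *m z) 0 0 = fnorm z ^+ 2 by rewrite fnorm_cV_sqr.
have nz0 : fnorm z != 0 by move: z_neq0; rewrite zz sqrf_eq0.
have nz : 0 < fnorm z by rewrite lt_neqAle eq_sym nz0 fnorm_ge0.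
have scale (N : 'M[R]_n.+1) : (((fnorm z)^-1 *: z)^T *m N *m ((fnorm z)^-1 *: z)) 0 0
    = (z^T *m N *m z) 0 0 / fnorm z ^+ 2.
  rewrite [(_ *: z)^T]linearZ /= -!scalemxAl -scalemxAr scalerA mxE; field.
  by [].
have := xmin ((fnorm z)^-1 *: z); rewrite -/c scale ler_pdivlMr ?exprn_gt0// -zz.
by apply; rewrite /K /=; have := scale 1%:M; rewrite !mulmx1 zz => ->; rewrite divff// sqrf_eq0.
Qed.

(** The reflection in the hyperplane orthogonal to [x - e] exchanges [e] and [x]; for [x = e] it is
    undefined and the identity serves. *)
Lemma Householder (R : realType) n (x : 'cV[R]_n.+1) : (x^T *m x) 0 0 = 1 ->
  exists H : 'M[R]_n.+1, [/\ H^T = H, H *m H = 1%:M & H *m delta_mx 0 0 = x].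
Proof.
move=> x1; pose e : 'cV[R]_n.+1 := delta_mx 0 0.
have [->|xe] := eqVneq x e.
  by exists 1%:M; rewrite trmx1 mulmx1 mul1mx.
pose u := x - e; pose a := (u^T *m u) 0 0.
have a0 : a != 0.
  apply: contra_neq xe => a0; apply/eqP; rewrite -subr_eq0 -/u; apply/eqP.
  by apply: fnorm_eq0; apply/eqP; rewrite -sqrf_eq0 fnorm_cV_sqr -/a a0.
have uu : u^T *m u = a%:M by rewrite [LHS]mx11_scalar.
have ue : u^T *m e = (- a / 2)%:M.
  rewrite [LHS]mx11_scalar; congr (_%:M).
  have ee : (e^T *m e) 0 0 = 1 by rewrite trmx_delta mul_delta_mx mxE !eqxx.
  have xx : (e^T *m x) 0 0 = (x^T *m e) 0 0.
    by rewrite -[e^T *m x]trmxK trmx_mul trmxK mxE.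
  rewrite /a /u ![(x - e)^T]linearB /= !mulmxBl !mulmxBr.
  move: ee xx x1; rewrite !mxE => ee xx x1; rewrite ee xx x1; lra.
pose H : 'M[R]_n.+1 := 1%:M - (2 / a) *: (u *m u^T).
exists H; split.
- by rewrite /H linearB /= trmx1 linearZ /= trmx_mul trmxK.
- have ww : u *m u^T *m (u *m u^T) = a *: (u *m u^T).
    by rewrite mulmxA -(mulmxA u) uu mul_mx_scalar scalemxAl.
  have kk : (2 / a) *: (u *m u^T) *m ((2 / a) *: (u *m u^T)) =
      (2 / a) *: (u *m u^T) + (2 / a) *: (u *m u^T).
    by rewrite -scalemxAl -scalemxAr ww !scalerA -scalerDl; congr (_ *: _); field.
  rewrite /H mulmxBl mul1mx mulmxBr mulmx1 kk; set v := (2 / a) *: _.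
  by rewrite (_ : v - (v + v) = - v) ?opprK ?subrK// opprD addrA subrr sub0r.
- rewrite /H -/e mulmxBl mul1mx -scalemxAl -mulmxA ue mul_mx_scalar scalerA.
  have -> : 2 / a * (- a / 2) = -1 by field.
  by rewrite scaleN1r opprK /u addrC subrK.
Qed.

(** Conjugation by a Householder reflection moves an eigenvector to the first basis vector; symmetry
    clears the first row along with the first column, and induction handles the remaining block. *)
Theorem spectral_sym (R : realType) n (M : 'M[R]_n) : M^T = M ->
  exists (Q : 'M[R]_n) (d : 'rV[R]_n),
    Q^T *m Q = 1%:M /\ M = Q *m diag_mx d *m Q^T.
Proof.
elim: n M => [|n IH] M Ms.
  by exists 1%:M, 0; split; apply/matrixP => -[].
have [x [c [x1 Mx]]] := sym_Rayleigh_min Ms.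
have [H [Hs HH He]] := Householder x1.
pose N : 'M[R]_(1 + n) := H *m M *m H.
have Ns : N^T = N by rewrite /N !trmx_mul Hs Ms mulmxA.
have e0E : delta_mx 0 0 = col_mx 1%:M 0 :> 'cV[R]_(1 + n).
  apply/colP => i; rewrite !mxE; case: splitP => j ij; rewrite !mxE -?(inj_eq val_inj) /= ij.
    by rewrite (ord1 j).
  by [].
have Ne : N *m col_mx 1%:M 0 = c *: col_mx 1%:M 0.
  by rewrite -e0E /N -!mulmxA He Mx -scalemxAr -He mulmxA HH mul1mx.
have [dl ul] : dlsubmx N = 0 /\ ulsubmx N = c%:M.
  move: Ne; rewrite -{1}(submxK N) mul_block_col !mulmx0 !mulmx1 !addr0.
  by rewrite scale_col_mx scaler0 scalemx1 => /eq_col_mx[-> ->].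
have ur : ursubmx N = 0.
  by rewrite -[N]Ns -trmx_dlsub dl trmx0.
have drs : (drsubmx N)^T = drsubmx N by rewrite trmx_drsub Ns.
have [Q' [d' [QQ drE]]] := IH _ drs.
exists (H *m (block_mx 1%:M 0 0 Q' : 'M[R]_(1 + n))), (row_mx c%:M d' : 'rV[R]_(1 + n)).
rewrite !trmx_mul Hs (@tr_block_mx _ 1 n 1 n) trmx1 !trmx0; split.
  rewrite mulmxA -(mulmxA _ H H) HH mulmx1 (@mulmx_block _ 1 n 1 n 1 n).
  by rewrite !mulmx0 !mul0mx !mulmx1 !addr0 add0r QQ -scalar_mx_block.
have -> : M = H *m N *m H.
  by rewrite /N !mulmxA HH mul1mx -mulmxA HH mulmx1.
rewrite -!mulmxA; congr (_ *m _); rewrite !mulmxA; congr (_ *m _).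
rewrite -[LHS](submxK N) dl ur ul drE (@diag_mx_row _ n 1) !(@mulmx_block _ 1 n 1 n 1 n).
rewrite !mulmx0 !mul0mx !mulmx1 !mul1mx !addr0 !add0r !mul0mx.
by congr (@block_mx _ 1 n 1 n _ _ _ _); apply/matrixP => i j; rewrite !mxE !ord1 eqxx.
Qed.

Lemma quad_diag (R : realType) n (d : 'rV[R]_n) (x : 'cV[R]_n) :
  (x^T *m diag_mx d *m x) 0 0 = \sum_i d 0 i * x i 0 ^+ 2.
Proof.
by rewrite mul_mx_diag mxE; apply: eq_bigr => i _; rewrite !mxE expr2 mulrCA mulrA.
Qed.

Lemma psd_diag_mx (R : realType) n (d : 'rV[R]_n) :
  (forall i, 0 <= d 0 i) -> psd (diag_mx d).
Proof.
move=> d_ge0; split; first exact: tr_diag_mx.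
move=> x; rewrite quad_diag; apply: sumr_ge0 => i _.
by rewrite mulr_ge0 ?sqr_ge0.
Qed.

Lemma psd_sqrt (R : realType) n (M : 'M[R]_n) : psd M ->
  exists Z, psd Z /\ Z *m Z = M.
Proof.
move=> Mp; have [Q [d [QQ ME]]] := spectral_sym Mp.1.
have dE : diag_mx d = Q^T *m M *m Q.
  by rewrite ME !mulmxA QQ mul1mx -mulmxA QQ mulmx1.
have d_ge0 i : 0 <= d 0 i.
  have := psd_diag_ge0 i (psd_congr Q Mp).
  by rewrite -dE mxE eqxx.
exists (Q *m diag_mx (\row_i Num.sqrt (d 0 i)) *m Q^T); split.
  rewrite -{1}[Q]trmxK; apply: psd_congr; apply: psd_diag_mx => i.
  by rewrite mxE sqrtr_ge0.
rewrite ME !mulmxA -(mulmxA _ Q^T) QQ mulmx1; congr (_ *m _).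
rewrite -mulmxA; congr (_ *m _); rewrite mulmx_diag; congr diag_mx.
by apply/rowP => i; rewrite !mxE -expr2 sqr_sqrtr.
Qed.

Lemma psd_tr_mul_ge0 (R : realType) n (A B : 'M[R]_n) :
  psd A -> psd B -> 0 <= \tr (A *m B).
Proof.
move=> Ap /psd_sqrt[Z [[Zs _] <-]].
by rewrite mulmxA mxtrace_mulC mulmxA -{1}Zs; exact/psd_tr_ge0/psd_congr.
Qed.

Lemma psdB_tr_le (R : realType) n (A B W : 'M[R]_n) :
  psd (B - A) -> psd W -> \tr (A *m W) <= \tr (B *m W).
Proof.
by move=> BA Wp; rewrite -subr_ge0 -linearB /= -mulmxBl psd_tr_mul_ge0.
Qed.

(** * Sorted eigenvalues *)

(** The product determines the multiset of roots and sorting determines their order, so the choice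
    made in [eigvals] is forced. *)
Lemma eigvalsE (R : realType) n (M : 'M[R]_n) (s : seq R) :
  sorted >=%R s -> char_poly M = \prod_(x <- s) ('X - x%:P) -> eigvals M = s.
Proof.
move=> ss Ms; rewrite /eigvals; case: xgetP => [t _ [tt Mt]|/(_ s)]; last by case.
apply: (sorted_eq (leT := >=%R)) => //.
- exact: ge_trans.
- exact: ge_anti.
by apply: prod_XsubC_eq; rewrite -Mt -Ms.
Qed.

Lemma char_poly_diag (R : realType) n (Q : 'M[R]_n) (d : 'rV[R]_n) (M : 'M[R]_n) :
  Q \in unitmx -> M *m Q = Q *m diag_mx d ->
  char_poly M = \prod_i ('X - (d 0 i)%:P).
Proof.
move=> Qu MQ.
have -> : M = Q *m diag_mx d *m invmx Q by rewrite -MQ mulmxK.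
rewrite /char_poly; set P := map_mx polyC Q.
have -> : char_poly_mx (Q *m diag_mx d *m invmx Q) =
   P *m char_poly_mx (diag_mx d) *m map_mx polyC (invmx Q).
  rewrite /char_poly_mx mulmxBr mulmxBl mul_mx_scalar -scalemxAl -map_mxM.
  by rewrite mulmxV// map_mx1 scalemx1 !map_mxM.
rewrite !det_mulmx mulrAC -det_mulmx -map_mxM mulmxV// map_mx1 det1 mul1r.
rewrite -/(char_poly _) char_poly_trig ?diag_mx_is_trig//.
by apply: eq_bigr => i _; rewrite mxE eqxx.
Qed.

Lemma eigvals_cat (R : realType) n (M : 'M[R]_n) (s1 s2 : seq R) :
  char_poly M = \prod_(x <- s1 ++ s2) ('X - x%:P) ->
  {in s1 & s2, forall x y, y <= x} ->
  eigvals M = sort >=%R s1 ++ sort >=%R s2.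
Proof.
move=> Ms le12; apply: eigvalsE; last first.
  by rewrite Ms; apply: perm_big; rewrite perm_sym perm_cat// perm_sort.
rewrite sorted_pairwise; last exact: ge_trans.
rewrite pairwise_cat -!sorted_pairwise; try exact: ge_trans.
rewrite !sort_sorted ?andbT; try exact: ge_total.
by apply/allrelP => x y; rewrite !mem_sort; exact: le12.
Qed.

(** * Perturbation of eigenspaces *)

(** The two blocks of an orthogonal matrix are kept apart, so that [n = k + l] is a consequence and
    not a type conversion. *)
Definition orth_split (R : realType) n k l
    (Q1 : 'M[R]_(n, k)) (Q2 : 'M[R]_(n, l)) : Prop :=
  [/\ Q1^T *m Q1 = 1%:M, Q2^T *m Q2 = 1%:M, Q1^T *m Q2 = 0
    & Q1 *m Q1^T + Q2 *m Q2^T = 1%:M].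

(** Neither block is sorted and ties between the blocks are allowed; a strict gap is a separate
    hypothesis where it matters. *)
Definition eigen_split (R : realType) n k l (M : 'M[R]_n)
    (Q1 : 'M[R]_(n, k)) (Q2 : 'M[R]_(n, l)) (d1 : 'rV[R]_k) (d2 : 'rV[R]_l) : Prop :=
  [/\ orth_split Q1 Q2, M *m Q1 = Q1 *m diag_mx d1, M *m Q2 = Q2 *m diag_mx d2
    & forall i j, d2 0 j <= d1 0 i].

Lemma orth_split_dim (R : realType) n k l (Q1 : 'M[R]_(n, k)) (Q2 : 'M[R]_(n, l)) :
  orth_split Q1 Q2 -> n = (k + l)%N.
Proof.
case=> q11 q22 _ /(congr1 mxtrace); rewrite mxtraceD mxtrace_mulC q11.
by rewrite mxtrace_mulC q22 !mxtrace1 -natrD => /eqP; rewrite eqr_nat => /eqP.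
Qed.

Lemma quad_trE (R : realType) n (M : 'M[R]_n) (u : 'cV[R]_n) :
  (u^T *m M *m u) 0 0 = \tr (u^T *m M *m u).
Proof. by rewrite /mxtrace big_ord1. Qed.

Lemma eigen_split_sum (R : realType) n k l M (Q1 : 'M[R]_(n, k)) (Q2 : 'M[R]_(n, l)) d1 d2 :
  eigen_split M Q1 Q2 d1 d2 ->
  M = Q1 *m diag_mx d1 *m Q1^T + Q2 *m diag_mx d2 *m Q2^T.
Proof.
by case=> -[_ _ _ q] m1 m2 _; rewrite -[LHS]mulmx1 -q mulmxDr !mulmxA m1 m2.
Qed.

Lemma eigen_split_quad (R : realType) n k l M (Q1 : 'M[R]_(n, k)) (Q2 : 'M[R]_(n, l)) d1 d2
    (u : 'cV[R]_n) :
  eigen_split M Q1 Q2 d1 d2 ->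
  (u^T *m M *m u) 0 0 = \sum_i d1 0 i * (Q1^T *m u) i 0 ^+ 2
                      + \sum_j d2 0 j * (Q2^T *m u) j 0 ^+ 2.
Proof.
move=> /eigen_split_sum ->; rewrite -!quad_diag !trmx_mul !trmxK.
by rewrite mulmxDr mulmxDl mxE !mulmxA.
Qed.

Lemma orth_split_norm (R : realType) n k l (Q1 : 'M[R]_(n, k)) (Q2 : 'M[R]_(n, l))
    (u : 'cV[R]_n) : orth_split Q1 Q2 ->
  (u^T *m u) 0 0 = \sum_i (Q1^T *m u) i 0 ^+ 2 + \sum_j (Q2^T *m u) j 0 ^+ 2.
Proof.
move=> q; have h : eigen_split 1%:M Q1 Q2 (const_mx 1) (const_mx 1).
  by split=> // [||i j]; rewrite ?mxE// diag_const_mx mulmx1 mul1mx.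
have := eigen_split_quad u h; rewrite mulmx1 => ->.
by congr (_ + _); apply: eq_bigr => i _; rewrite mxE mul1r.
Qed.

(** Only eigenvalues met by a nonzero coordinate of [u] count, which is what min-max arguments with
    special test vectors require. *)
Lemma eigen_split_quad_le (R : realType) n k l M (Q1 : 'M[R]_(n, k)) (Q2 : 'M[R]_(n, l)) d1 d2
    (u : 'cV[R]_n) c :
  eigen_split M Q1 Q2 d1 d2 ->
  (forall i, (Q1^T *m u) i 0 != 0 -> d1 0 i <= c) ->
  (forall j, (Q2^T *m u) j 0 != 0 -> d2 0 j <= c) ->
  (u^T *m M *m u) 0 0 <= c * (u^T *m u) 0 0.
Proof.
move=> h h1 h2; have [q _ _ _] := h.
rewrite (eigen_split_quad u h) (orth_split_norm u q) mulrDr !mulr_sumr.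
have le (t d : R) : (t != 0 -> d <= c) -> d * t ^+ 2 <= c * t ^+ 2.
  have [->|t0 /(_ isT)] := eqVneq t 0; first by rewrite expr0n !mulr0.
  exact/ler_wpM2r/sqr_ge0.
by apply: lerD; apply: ler_sum => i _; apply: le => ?; first [exact: h1|exact: h2].
Qed.

Lemma eigen_split_quad_ge (R : realType) n k l M (Q1 : 'M[R]_(n, k)) (Q2 : 'M[R]_(n, l)) d1 d2
    (u : 'cV[R]_n) c :
  eigen_split M Q1 Q2 d1 d2 ->
  (forall i, (Q1^T *m u) i 0 != 0 -> c <= d1 0 i) ->
  (forall j, (Q2^T *m u) j 0 != 0 -> c <= d2 0 j) ->
  c * (u^T *m u) 0 0 <= (u^T *m M *m u) 0 0.
Proof.
move=> h h1 h2; have [q _ _ _] := h.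
rewrite (eigen_split_quad u h) (orth_split_norm u q) mulrDr !mulr_sumr.
have le (t d : R) : (t != 0 -> c <= d) -> c * t ^+ 2 <= d * t ^+ 2.
  have [->|t0 /(_ isT)] := eqVneq t 0; first by rewrite expr0n !mulr0.
  exact/ler_wpM2r/sqr_ge0.
by apply: lerD; apply: ler_sum => i _; apply: le => ?; first [exact: h1|exact: h2].
Qed.

Lemma exists_ker (R : realType) p k (A : 'M[R]_(p, k)) : (p < k)%N ->
  exists2 x : 'cV[R]_k, x != 0 & A *m x = 0.
Proof.
move=> pk; have : kermx A^T != 0.
  rewrite kermx_eq0 /row_free neq_ltn.
  by rewrite (leq_ltn_trans (rank_leq_col _) pk).
case/rowV0Pn => v /sub_kermxP vA v0; exists v^T.
  by rewrite -(inj_eq (@trmx_inj _ _ _)) trmxK trmx0.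
by apply: (@trmx_inj _ _ _); rewrite trmx_mul trmxK vA trmx0.
Qed.

Lemma norm_cV_gt0 (R : realType) n (u : 'cV[R]_n) : u != 0 -> 0 < (u^T *m u) 0 0.
Proof.
move=> u0; rewrite -fnorm_cV_sqr exprn_gt0// lt_neqAle fnorm_ge0 andbT eq_sym.
by apply: contra_neq u0; exact: fnorm_eq0.
Qed.

Lemma orth_split_fnorm (R : realType) n k l p (Q1 : 'M[R]_(n, k)) (Q2 : 'M[R]_(n, l))
    (A : 'M[R]_(n, p)) : orth_split Q1 Q2 ->
  fnorm (Q1^T *m A) ^+ 2 + fnorm (Q2^T *m A) ^+ 2 = fnorm A ^+ 2.
Proof.
case=> _ _ _ q; rewrite !fnorm_sqr -mxtraceD !trmx_mul !trmxK !mulmxA.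
by rewrite -mulmxDl -!mulmxA -mulmxDr q mulmx1.
Qed.

Lemma ler_fnorm_split (R : realType) n k l p (Q1 : 'M[R]_(n, k)) (Q2 : 'M[R]_(n, l))
    (A : 'M[R]_(n, p)) : orth_split Q1 Q2 ->
  fnorm (Q1^T *m A) <= fnorm A /\ fnorm (Q2^T *m A) <= fnorm A.
Proof.
move=> q; rewrite -![fnorm (_ *m _) <= _](@ler_pXn2r _ 2)// ?nnegrE ?fnorm_ge0//.
by rewrite -(orth_split_fnorm A q) lerDl lerDr !sqr_ge0.
Qed.

Lemma ler_fnorm_entry (R : realType) p q (A B : 'M[R]_(p, q)) c : 0 <= c ->
  (forall i j, c * `|A i j| <= `|B i j|) -> c * fnorm A <= fnorm B.
Proof.
move=> c0 h; rewrite -ler_sqr ?nnegrE ?mulr_ge0 ?fnorm_ge0// exprMn !fnorm_sqr.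
rewrite !mxtrace_mulTmx mulr_sumr; apply: ler_sum => i _; rewrite mulr_sumr.
apply: ler_sum => j _; rewrite -!expr2 -(real_normK (num_real (A i j))).
rewrite -(real_normK (num_real (B i j))) -exprMn ler_sqr ?nnegrE//.
by rewrite mulr_ge0.
Qed.

(** The Gram matrix of [P *m N] is [G *m G], so division by [G] orthonormalizes the columns; the
    factor [N G^-1] is invertible and keeps the span. *)
Lemma orthonormal_normalize (R : realType) n k (P : 'M[R]_(n, k)) (N G : 'M[R]_k) :
  P^T *m P = 1%:M -> N \in unitmx -> G^T = G -> G *m G = N^T *m N ->
  orthonormal_basis (P *m N *m invmx G) (colspace P).
Proof.
move=> PP Nu Gs GG.
have Gu : G \in unitmx.
  have : G *m G \in unitmx by rewrite GG unitmx_mul unitmx_tr Nu.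
  by rewrite unitmx_mul => /andP[].
split.
  rewrite !trmx_mul trmx_inv Gs !mulmxA -(mulmxA _ P^T) PP mulmx1.
  by rewrite -(mulmxA (invmx G)) -GG !mulmxA mulVmx// mul1mx mulmxV.
apply: eq_genmx; rewrite -mulmxA trmx_mul; apply: eqmxMfull.
by rewrite row_full_unit unitmx_tr unitmx_mul Nu unitmx_inv.
Qed.

(** The other [k - 1] rows impose fewer conditions than there are unknowns. This supplies the test
    vectors for comparing individual eigenvalues. *)
Lemma exists_ker_row' (R : realType) k (A : 'M[R]_k) (i : 'I_k) :
  exists2 x : 'cV[R]_k, x != 0 & forall j, (A *m x) j 0 != 0 -> j = i.
Proof.
have [|x x0 Ax] := @exists_ker R _ _ (row' i A); first by case: k A i => [? []|].
exists x => // j; have [//|] := eqVneq j i.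
rewrite eq_sym => /unlift_some[j' -> _] /eqP; case.
have := congr1 (fun B : 'cV_k.-1 => B j' 0) Ax; rewrite [RHS]mxE => <-.
by rewrite mxE [RHS]mxE; apply: eq_bigr => t _; rewrite [in RHS]mxE.
Qed.

Section Perturbation.
Variables (R : realType) (n k l : nat) (M Me : 'M[R]_n).
Variables (Q1 P1 : 'M[R]_(n, k)) (Q2 P2 : 'M[R]_(n, l)).
Variables (d1 e1 : 'rV[R]_k) (d2 e2 : 'rV[R]_l) (a b : R).
Hypotheses (hM : eigen_split M Q1 Q2 d1 d2) (hMe : eigen_split Me P1 P2 e1 e2).
Hypotheses (ad : forall i, a <= d1 0 i) (db : forall j, d2 0 j <= b).
Hypotheses (ab : 0 < a - b) (hE : fnorm (Me - M) <= (a - b) / 5).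

Let Q : orth_split Q1 Q2. Proof. by case: hM. Qed.
Let P : orth_split P1 P2. Proof. by case: hMe. Qed.
(** [Y] and [Z] are the coordinates of [P1] in the basis [(Q1, Q2)]; their singular values are the
    cosines and sines of the angles between the two eigenspaces. *)
Let Z := Q2^T *m P1.
Let Y := Q1^T *m P1.

(** A Weyl-type bound. The test vector lies in the range of [Q1], where [M] is at least [a], and is
    orthogonal to every column of [P1] but the i-th, so that [Me] is at most [e1 0 i] on it. *)
Lemma perturbed_eigenvalue_ge i : a - (a - b) / 5 <= e1 0 i.
Proof.
have [q11 q22 q12 _] := Q.
have [x x0 Ax] := exists_ker_row' (P1^T *m Q1) i.
pose u := Q1 *m x.
have uu : (u^T *m u) 0 0 = (x^T *m x) 0 0.
  by rewrite trmx_mul -mulmxA (mulmxA Q1^T) q11 mul1mx.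
have upos : 0 < (u^T *m u) 0 0 by rewrite uu norm_cV_gt0.
have lo : a * (u^T *m u) 0 0 <= (u^T *m M *m u) 0 0.
  apply: eigen_split_quad_ge hM _ _ => [j _|j]; first exact: ad.
  by rewrite /u mulmxA -[Q2^T *m _]trmxK trmx_mul trmxK q12 trmx0 mul0mx mxE eqxx.
have hi : (u^T *m Me *m u) 0 0 <= e1 0 i * (u^T *m u) 0 0.
  have [_ _ _ e21] := hMe.
  apply: eigen_split_quad_le hMe _ _ => [j|j _]; last exact: e21.
  by rewrite mulmxA => /Ax ->.
have Eu := quad_le_fnorm (Me - M) u.
rewrite -(ler_pM2r upos) mulrBl.
have : (u^T *m (Me - M) *m u) 0 0 = (u^T *m Me *m u) 0 0 - (u^T *m M *m u) 0 0.
  by rewrite mulmxBr mulmxBl !mxE.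
move: Eu => /ler_normlP[Eu _] EE.
have := ler_wpM2r (ltW upos) hE; move: ab; lra.
Qed.

(* e1 i and d2 j are separated, so the Sylvester equation satisfied by Z can be
   solved entrywise. *)
Let ZE i j : Z j i * (e1 0 i - d2 0 j) = (Q2^T *m (Me - M) *m P1) j i.
Proof.
have Ms : Q2^T *m M = diag_mx d2 *m Q2^T.
  have [[_ q22 q12 _] _ _ _] := hM.
  rewrite (eigen_split_sum hM) mulmxDr !mulmxA q22 mul1mx.
  by rewrite -[Q2^T *m Q1]trmxK trmx_mul trmxK q12 trmx0 !mul0mx add0r.
have [_ MP _ _] := hMe.
rewrite mulmxBr mulmxBl -(mulmxA _ Me) MP Ms !mulmxA -/Z -(mulmxA _ _ P1) -/Z.
by rewrite mul_mx_diag mul_diag_mx !mxE; ring.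
Qed.

(** The eigenvalues [e1 0 i] and [d2 0 j] are at least [4/5] of the gap apart. *)
Let fZ : (a - b) * (4 / 5) * fnorm Z <= fnorm (Q2^T *m (Me - M) *m P1).
Proof.
apply: ler_fnorm_entry => [|j i]; first by move: ab; lra.
rewrite -ZE normrM mulrC ler_wpM2l// ger0_norm.
  by move: ab (perturbed_eigenvalue_ge i) (db j); lra.
by move: ab (perturbed_eigenvalue_ge i) (db j); lra.
Qed.

Let fE_Pi p (B : 'M[R]_(p, n)) : fnorm (B *m P1) <= fnorm B.
Proof.
by rewrite -fnormT -[leRHS]fnormT trmx_mul; have [] := ler_fnorm_split B^T P.
Qed.

Let fZ4 : fnorm Z <= 1 / 4.
Proof.
have h1 := fE_Pi (Q2^T *m (Me - M)); have [_ h2] := ler_fnorm_split (Me - M) Q.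
rewrite -(ler_pM2l ab); move: fZ hE h1 h2; lra.
Qed.

Let YZ : Y^T *m Y + Z^T *m Z = 1%:M.
Proof.
have [_ _ _ q] := Q; have [p11 _ _ _] := P.
transitivity (P1^T *m ((Q1 *m Q1^T + Q2 *m Q2^T) *m P1)); last by rewrite q mul1mx.
by rewrite mulmxDl mulmxDr !trmx_mul !trmxK !mulmxA.
Qed.

(** If [Y x = 0], then [|x| = |Z x| <= |x| / 4]. *)
Let Yu : Y \in unitmx.
Proof.
rewrite -unitmx_tr -row_free_unit -kermx_eq0; apply/rowV0P => v /sub_kermxP vY.
pose x := v^T; have Yx : Y *m x = 0.
  by apply: (@trmx_inj _ _ _); rewrite trmx_mul trmxK vY trmx0.
suff x0 : x = 0 by rewrite -[v]trmxK -/x x0 trmx0.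
apply: fnorm_eq0; apply/eqP; rewrite eq_le fnorm_ge0 andbT.
have : fnorm x ^+ 2 = fnorm (Z *m x) ^+ 2.
  rewrite !fnorm_sqr; transitivity (\tr (x^T *m ((Y^T *m Y + Z^T *m Z) *m x))).
    by rewrite YZ mul1mx.
  by rewrite mulmxDl -(mulmxA Y^T) Yx mulmx0 add0r (trmx_mul Z) !mulmxA.
move/eqP; rewrite eqrXn2 ?fnorm_ge0// => /eqP xE.
have := ler_fnormM Z x; rewrite -xE => h.
have := ler_wpM2r (fnorm_ge0 x) fZ4; lra.
Qed.

Lemma perturbed_eigenspace_basis : exists V : 'M[R]_(l, k),
  orthonormal_basis ((Q1 + Q2 *m V) *m invsqrtmx (1%:M + V^T *m V)) (colspace P1).
Proof.
have [q11 q22 q12 q] := Q; have [p11 _ _ _] := P.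
(* Normalizing the [Q1]-component of [P1] to the identity turns [P1] into [Q1 + Q2 *m V]. *)
pose N := invmx Y; pose V := Z *m N; exists V.
have QV : Q1 + Q2 *m V = P1 *m N.
  rewrite /V -[Q1](mulmxK Yu) -/N mulmxA -mulmxDl /Y /Z !mulmxA -mulmxDl.
  by rewrite q mul1mx.
clearbody V.
(* The Gram matrix of [Q1 + Q2 *m V] is computed in two ways, the second through [P1 *m N]. *)
have VV : 1%:M + V^T *m V = N^T *m N.
  have q21 : Q2^T *m Q1 = 0 by rewrite -[LHS]trmxK trmx_mul trmxK q12 trmx0.
  transitivity ((Q1 + Q2 *m V)^T *m (Q1 + Q2 *m V)).
    rewrite [(_ + _)^T]linearD /= trmx_mul mulmxDl !mulmxDr q11 !mulmxA q12.
    by rewrite -(mulmxA _ _ Q1) q21 mulmx0 mul0mx add0r addr0 -(mulmxA V^T) q22 mulmx1.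
  by rewrite QV trmx_mul mulmxA -(mulmxA _ P1^T) p11 mulmx1.
have psdVV : psd (1%:M + V^T *m V).
  rewrite VV -[N^T]mulmx1; apply: psd_congr; split; first exact: trmx1.
  by move=> x; rewrite mulmx1 -fnorm_cV_sqr exprn_ge0// fnorm_ge0.
rewrite QV /invsqrtmx.
have [[Gs _] GG] : psd (sqrtmx (1%:M + V^T *m V)) /\
    sqrtmx (1%:M + V^T *m V) *m sqrtmx (1%:M + V^T *m V) = 1%:M + V^T *m V.
  exact: (xgetPex 0 (psd_sqrt psdVV)).
apply: orthonormal_normalize => //; first by rewrite unitmx_inv.
by rewrite GG VV.
Qed.

(** The Frobenius norm is bounded here because it dominates the spectral norm in [subspace_dist]. *)
Lemma perturbed_eigenspace_dist :
  fnorm (Q1 *m Q1^T - P1 *m P1^T) <=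
    4 * fnorm (Q1^T *m (Me - M) *m Q2) / (a - b).
Proof.
have [q11 q22 q12 q] := Q; have [p11 _ _ _] := P.
(* Both spectral decompositions are symmetric, hence so is the perturbation. *)
have Es : (Me - M)^T = Me - M.
  rewrite linearB /= (eigen_split_sum hM) (eigen_split_sum hMe).
  by rewrite ![(_ + _)^T]linearD /= !trmx_mul !trmxK !tr_diag_mx !mulmxA.
have E21 : fnorm (Q1^T *m (Me - M) *m Q2) = fnorm (Q2^T *m (Me - M) *m Q1).
  by rewrite -fnormT !trmx_mul trmxK Es mulmxA.
have P1E : P1 = Q1 *m Y + Q2 *m Z by rewrite !mulmxA -mulmxDl q mul1mx.
(* The right-hand side of the Sylvester equation contains [Z] again; absorbing that term leaves
   [4/5 - 1/5 = 3/5] of the gap on the left. *)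
have bnd : fnorm (Q2^T *m (Me - M) *m P1) <=
    fnorm (Q2^T *m (Me - M) *m Q1) + (a - b) / 5 * fnorm Z.
  rewrite [in leLHS]P1E mulmxDr; apply: le_trans (ler_fnormD _ _) _; apply: lerD.
    rewrite /Y !mulmxA; apply: le_trans (fE_Pi _) _.
    by rewrite -[leLHS]fnormT trmx_mul trmxK (fnorm_mulQ _ q11) fnormT.
  rewrite mulmxA; apply: le_trans (ler_fnormM _ _) _; rewrite ler_wpM2r ?fnorm_ge0//.
  apply: le_trans hE; apply: (@le_trans _ _ (fnorm (Q2^T *m (Me - M)))).
    rewrite -fnormT trmx_mul -[leRHS]fnormT.
    by have [] := ler_fnorm_split (Q2^T *m (Me - M))^T Q.
  by have [] := ler_fnorm_split (Me - M) Q.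
(* Both projections have trace [k], so the square is [2 k - 2 |Y|^2], and [|Y|^2 + |Z|^2 = k]. *)
have nE : fnorm (Q1 *m Q1^T - P1 *m P1^T) ^+ 2 = 2 * fnorm Z ^+ 2.
  have YY : Y^T *m Y = P1^T *m Q1 *m Q1^T *m P1.
    by rewrite /Y trmx_mul trmxK !mulmxA.
  have := orth_split_fnorm P1 Q; rewrite -/Y -/Z !fnorm_sqr p11 YY.
  rewrite [(_ - _)^T]linearB /= !trmx_mul !trmxK !mulmxBl !mulmxBr !mulmxA.
  rewrite -(mulmxA Q1 Q1^T Q1) q11 mulmx1 -(mulmxA P1 P1^T P1) p11 mulmx1.
  rewrite !linearB /= (mxtrace_mulC Q1 Q1^T) q11 (mxtrace_mulC P1 P1^T) p11.
  rewrite [\tr (P1 *m P1^T *m Q1 *m Q1^T)]mxtrace_mulC !mulmxA.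
  rewrite [\tr (Q1 *m Q1^T *m P1 *m P1^T)]mxtrace_mulC !mulmxA.
  have -> : \tr (Q1^T *m P1 *m P1^T *m Q1) = \tr (P1^T *m Q1 *m Q1^T *m P1).
    by rewrite -mulmxA mxtrace_mulC mulmxA.
  lra.
rewrite ler_pdivlMr// E21 -(@ler_pXn2r _ 2)// ?nnegrE ?mulr_ge0 ?fnorm_ge0 ?(ltW ab)//.
rewrite exprMn nE exprMn; set e := fnorm (Q2^T *m _ *m Q1) in bnd *.
have h : (a - b) * fnorm Z <= 5 / 3 * e by have := fZ; lra.
have : ((a - b) * fnorm Z) ^+ 2 <= (5 / 3 * e) ^+ 2.
  by rewrite ler_pXn2r // nnegrE mulr_ge0 ?fnorm_ge0 ?(ltW ab) // fnorm_ge0.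
(* The constant 4 suffices because [2 (5/3)^2 = 50/9] is at most 16. *)
rewrite !exprMn; have := sqr_ge0 e; lra.
Qed.

End Perturbation.

(** * Orthogonal projections and the distance between subspaces *)

(** Subspaces are row spaces: the rows of [Q *m Q^T] lie in the subspace, and those of
    [1 - Q *m Q^T] in the complement, which is the set of rows [v] with [v *m Q = 0]. *)
Lemma orthproj_colspace (R : realType) n k (Q : 'M[R]_(n, k)) :
  Q^T *m Q = 1%:M -> orthproj (colspace Q) = Q *m Q^T.
Proof.
move=> QQ; set U := colspace Q; set W := orthcompl U.
have UQ : (U :=: Q^T)%MS by exact: genmxE.
have WP p (v : 'M[R]_(p, n)) : (v <= W)%MS = (v *m Q == 0).
  rewrite genmxE sub_kermx; apply/eqP/eqP => [vU|vQ].
    have /submxP[B QB] : (Q^T <= U)%MS by rewrite UQ.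
    by rewrite -[Q]trmxK QB trmx_mul mulmxA vU mul0mx.
  have /submxP[B ->] : (U <= Q^T)%MS by rewrite UQ.
  by rewrite trmx_mul trmxK mulmxA vQ mul0mx.
have UW : (U :&: W)%MS = 0.
  apply/eqP/rowV0P => v; rewrite sub_capmx WP UQ => /andP[/submxP[w ->]].
  by rewrite -mulmxA QQ mulmx1 => /eqP ->; rewrite mul0mx.
have e : 1%:M = Q *m Q^T + (1%:M - Q *m Q^T) by rewrite addrC subrK.
rewrite /orthproj -[LHS]mul1mx {1}e mulmxDl.
rewrite (proj_mx_id UW); last by rewrite UQ submxMl.
rewrite (proj_mx_0 UW) ?addr0// WP.
by rewrite mulmxBl mul1mx -mulmxA QQ mulmx1 subrr.
Qed.

Lemma spectral_norm_le (R : realType) p q (M : 'M[R]_(p, q)) :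
  spectral_norm M <= fnorm M.
Proof.
apply: ge_sup; first by exists (fnorm (M *m (0 : 'cV_q))), 0 => //=; rewrite fnorm0.
move=> _ [x /= x1 <-]; apply: le_trans (ler_fnormM _ _) _.
by rewrite ler_piMr// fnorm_ge0.
Qed.

Lemma subspace_dist_le (R : realType) n k (Q P : 'M[R]_(n, k)) :
  Q^T *m Q = 1%:M -> P^T *m P = 1%:M ->
  subspace_dist (colspace Q) (colspace P) <= fnorm (Q *m Q^T - P *m P^T).
Proof.
by move=> QQ PP; rewrite /subspace_dist !orthproj_colspace// spectral_norm_le.
Qed.

(** * Sorted eigenvalues of a split matrix *)

Lemma char_poly_split (R : realType) n k l M (Q1 : 'M[R]_(n, k)) (Q2 : 'M[R]_(n, l)) d1 d2 :
  eigen_split M Q1 Q2 d1 d2 ->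
  char_poly M = \prod_(x <- [seq d1 0 i | i : 'I_k] ++ [seq d2 0 j | j : 'I_l])
                  ('X - x%:P).
Proof.
move=> h; have [q m1 m2 _] := h; have nE := orth_split_dim q; subst n.
have [q11 q22 q12 q1] := q.
pose Q := row_mx Q1 Q2.
have QQ : Q *m Q^T = 1%:M by rewrite tr_row_mx mul_row_col.
have [Qu _] := mulmx1_unit QQ.
rewrite (@char_poly_diag _ _ Q (row_mx d1 d2))//.
  rewrite big_cat !big_image /= big_split_ord /=.
  by congr (_ * _); apply: eq_bigr => i _; rewrite ?row_mxEl ?row_mxEr.
by rewrite mul_mx_row m1 m2 diag_mx_row mul_row_block !mulmx0 addr0 add0r.
Qed.

Lemma sort_ge_last (R : realType) (s : seq R) x : x \in s ->
  nth 0 (sort >=%R s) (size s).-1 <= x.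
Proof.
rewrite -(mem_sort >=%R) => xs; rewrite -[leRHS](nth_index 0 xs).
have lt : (index x (sort >=%R s) < size s)%N by rewrite -(size_sort >=%R) index_mem.
have := @sorted_leq_nth _ >=%R (@ge_trans _ R) (@lexx _ R) 0 _ (sort_sorted (@ge_total _ R) s).
have s0 := leq_ltn_trans (leq0n _) lt.
by apply; rewrite ?inE ?size_sort ?ltn_predL// -ltnS prednK.
Qed.

Lemma sort_ge_head (R : realType) (s : seq R) x : x \in s ->
  x <= nth 0 (sort >=%R s) 0.
Proof.
rewrite -(mem_sort >=%R) => xs; rewrite -[leLHS](nth_index 0 xs).
have lt : (index x (sort >=%R s) < size s)%N by rewrite -(size_sort >=%R) index_mem.
have := @sorted_leq_nth _ >=%R (@ge_trans _ R) (@lexx _ R) 0 _ (sort_sorted (@ge_total _ R) s).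
have s0 := leq_ltn_trans (leq0n _) lt.
by apply; rewrite ?inE ?size_sort.
Qed.

Section LambdaSplit.
Variables (R : realType) (n k l : nat) (M : 'M[R]_n).
Variables (Q1 : 'M[R]_(n, k)) (Q2 : 'M[R]_(n, l)) (d1 : 'rV[R]_k) (d2 : 'rV[R]_l).
Hypothesis hM : eigen_split M Q1 Q2 d1 d2.

Let s1 := [seq d1 0 i | i : 'I_k].
Let s2 := [seq d2 0 j | j : 'I_l].
Let size1 : size s1 = k. Proof. by rewrite size_image card_ord. Qed.
Let size2 : size s2 = l. Proof. by rewrite size_image card_ord. Qed.

Let eigvalsM : eigvals M = sort >=%R s1 ++ sort >=%R s2.
Proof.
apply: eigvals_cat; first exact: char_poly_split hM.
by move=> _ _ /mapP[i _ ->] /mapP[j _ ->]; have [_ _ _] := hM; apply.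
Qed.

Let mem1 i : d1 0 i \in s1. Proof. by apply: map_f; rewrite mem_enum. Qed.
Let mem2 j : d2 0 j \in s2. Proof. by apply: map_f; rewrite mem_enum. Qed.

Let lambda1 : (0 < k)%N -> lambda k M = nth 0 (sort >=%R s1) (size s1).-1.
Proof. by move=> k0; rewrite /lambda eigvalsM nth_cat size_sort size1 ltn_predL k0. Qed.

Let lambda2 : lambda k.+1 M = nth 0 (sort >=%R s2) 0.
Proof. by rewrite /lambda eigvalsM nth_cat size_sort size1 /= ltnn subnn. Qed.

(** The first [k] sorted eigenvalues are those of the block [Q1], so the last of them is the
    smallest of that block. *)
Lemma lambda_split_le i : lambda k M <= d1 0 i.
Proof. by rewrite lambda1 ?(leq_ltn_trans _ (ltn_ord i))// sort_ge_last. Qed.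

Lemma lambda_split_ge j : d2 0 j <= lambda k.+1 M.
Proof. by rewrite lambda2 sort_ge_head. Qed.

Lemma lambda_split_attained1 : (0 < k)%N -> exists i, lambda k M = d1 0 i.
Proof.
move=> k0; rewrite lambda1//.
have : nth 0 (sort >=%R s1) (size s1).-1 \in s1.
  by rewrite -(mem_sort >=%R) mem_nth// size_sort size1 ltn_predL.
by case/mapP => i _ ->; exists i.
Qed.

Lemma lambda_split_attained2 : (0 < l)%N -> exists j, lambda k.+1 M = d2 0 j.
Proof.
move=> l0; rewrite lambda2.
have : nth 0 (sort >=%R s2) 0 \in s2.
  by rewrite -(mem_sort >=%R) mem_nth// size_sort size2.
by case/mapP => i _ ->; exists i.
Qed.

(** With an empty second block the list of eigenvalues has length [k], and [lambda k.+1] reads the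
    default value 0. *)
Lemma lambda_split_default : l = 0%N -> lambda k.+1 M = 0.
Proof. by move=> l0; rewrite lambda2 nth_default// size_sort size2 l0. Qed.

End LambdaSplit.

Theorem eigenspace_perturbation (R : realType) n k l (M Me : 'M[R]_n)
    (Q1 P1 : 'M[R]_(n, k)) (Q2 P2 : 'M[R]_(n, l)) d1 d2 e1 e2 :
  eigen_split M Q1 Q2 d1 d2 -> eigen_split Me P1 P2 e1 e2 ->
  ((0 < k)%N -> lambda k.+1 M < lambda k M) ->
  fnorm (Me - M) <= (lambda k M - lambda k.+1 M) / 5 ->
  (exists V : 'M[R]_(l, k), orthonormal_basis
     ((Q1 + Q2 *m V) *m invsqrtmx (1%:M + V^T *m V)) (colspace P1)) /\
  subspace_dist (colspace Q1) (colspace P1) <=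
    4 * fnorm (Q1^T *m (Me - M) *m Q2) / (lambda k M - lambda k.+1 M).
Proof.
move=> hM hMe gap hE.
have [[q11 _ _ _] _ _ _] := hM; have [[p11 _ _ _] _ _ _] := hMe.
(* For [k = 0] the truncated index makes [lambda 0] and [lambda 1] the same number; the quotient by
   zero is 0, and both subspaces are trivial. *)
case: (posnP k) => [k0|/gap {}gap].
  subst k; rewrite /lambda /= subrr invr0 mulr0; split.
    exists 0; split; first by apply/matrixP => -[].
    by rewrite /colspace !flatmx0.
  apply: le_trans (subspace_dist_le q11 p11) _.
  by rewrite (thinmx0 Q1) (thinmx0 P1) mul0mx subrr fnorm0.
have ab : 0 < lambda k M - lambda k.+1 M by rewrite subr_gt0.
have ad := lambda_split_le hM; have db := lambda_split_ge hM.
split; first exact: perturbed_eigenspace_basis hM hMe ad db ab hE.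
apply: le_trans (subspace_dist_le q11 p11) _.
exact: perturbed_eigenspace_dist hM hMe ad db ab hE.
Qed.

Lemma lambda_minP (R : realType) n (U : 'M[R]_n) : U^T = U ->
  psd (U - (lambda_min U)%:M) /\ (psd U -> 0 <= lambda_min U).
Proof.
move=> Us; have [Q [d [QQ UE]]] := spectral_sym Us.
have QQ' : Q *m Q^T = 1%:M by rewrite mulmx1C.
have UQ : U *m Q = Q *m diag_mx d by rewrite UE -mulmxA QQ mulmx1.
(* The whole eigenbasis forms the first block, so that [lambda n] is its least eigenvalue. *)
have hU : eigen_split U Q (0 : 'M[R]_(n, 0)) d 0.
  split=> // [||i []//]; last by rewrite !mul0mx mulmx0.
  by split; rewrite ?mulmx0 ?mul0mx ?addr0//; apply/matrixP => -[].
have le i := lambda_split_le hU i.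
split.
  have -> : U - (lambda_min U)%:M =
      Q^T^T *m diag_mx (d - const_mx (lambda_min U)) *m Q^T.
    rewrite trmxK linearB /= diag_const_mx mulmxBr mulmxBl -UE.
    by rewrite mul_mx_scalar -scalemxAl QQ' scalemx1.
  by apply/psd_congr/psd_diag_mx => i; rewrite !mxE subr_ge0; exact: le.
move=> Up; rewrite /lambda_min; case: (posnP n) => [n0|n0].
  by subst n; rewrite -[lambda 0 U]/(lambda 1 U) (lambda_split_default hU).
have [i ->] := lambda_split_attained1 hU n0.
have := psd_diag_ge0 i (psd_congr Q Up).
have -> : Q^T *m U *m Q = diag_mx d by rewrite -mulmxA UQ mulmxA QQ mul1mx.
by rewrite mxE eqxx.
Qed.

(** * Strong duality *)

Lemma psdD (R : realType) n (A B : 'M[R]_n) : psd A -> psd B -> psd (A + B).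
Proof.
move=> [As Ap] [Bs Bp]; split; first by rewrite linearD /= As Bs.
by move=> x; rewrite mulmxDr mulmxDl mxE addr_ge0.
Qed.

Lemma psdZ (R : realType) n (A : 'M[R]_n) t : 0 <= t -> psd A -> psd (t *: A).
Proof.
move=> t0 [As Ap]; split; first by rewrite linearZ /= As.
by move=> x; rewrite -scalemxAr -scalemxAl mxE mulr_ge0.
Qed.

(** The cone is an intersection of closed trace conditions: symmetry is tested against the matrices
    [A - A^T], nonnegativity against [x *m x^T]. *)
Lemma psd_closed (R : realType) n : closed [set X : 'M[R]_n | psd X].
Proof.
rewrite (_ : mkset _ =
   (\bigcap_(A in setT) [set X : 'M[R]_n | \tr ((A - A^T) *m X) = 0]) `&`
   (\bigcap_(x in setT) [set X : 'M[R]_n | 0 <= \tr ((x *m (x : 'cV[R]_n)^T) *m X)])).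
  apply: closedI; apply: closed_bigI => A _.
    apply: ((continuous_closedP (fun X : 'M[R]_n => \tr ((A - A^T) *m X))).1 _ [set 0]).
      exact: mxtrace_mul_continuous.
    exact: closed_eq.
  apply: ((continuous_closedP (fun X : 'M[R]_n => \tr (A *m A^T *m X))).1 _ [set t | 0 <= t]).
    exact: mxtrace_mul_continuous.
  exact: closed_ge.
have trE (x : 'cV[R]_n) (X : 'M[R]_n) : \tr (x *m x^T *m X) = (x^T *m X *m x) 0 0.
  by rewrite quad_trE -mulmxA mxtrace_mulC.
apply/seteqP; split => X /=.
  move=> [Xs Xp]; split=> [A _|x _] /=; last by rewrite trE.
  rewrite mulmxBl linearB /= -[X in _ - \tr (_ *m X)]Xs -trmx_mul mxtrace_tr.
  by rewrite (mxtrace_mulC X) subrr.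
move=> [Xs Xp]; split=> [|x]; last by rewrite -trE; exact: (Xp x I).
apply/matrixP => i j; rewrite mxE.
have := Xs (delta_mx i j) I; rewrite /= mulmxBl linearB /= trmx_delta.
have trd a b : \tr (delta_mx a b *m X) = X b a.
  have -> : delta_mx a b = (delta_mx a 0 : 'cV[R]_n) *m delta_mx 0 b by rewrite mul_delta_mx.
  rewrite -mulmxA mxtrace_mulC -rowE -colE /mxtrace big_ord1 !mxE.
  by [].
by rewrite !trd => /eqP; rewrite subr_eq0 => /eqP.
Qed.

Lemma posdef_psd (R : realType) n (S : 'M[R]_n) : posdef S -> psd S.
Proof.
move=> [Ss Sp]; split=> // x; have [->|x0] := eqVneq x 0.
  by rewrite mulmx0 mxE.
exact/ltW/Sp.
Qed.

Lemma posdef_unit (R : realType) n (S : 'M[R]_n) : posdef S -> S \in unitmx.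
Proof.
move=> [Ss Sp]; rewrite -row_free_unit -kermx_eq0; apply/rowV0P => v /sub_kermxP vS.
apply/eqP/negPn/negP => v0.
have vT : v^T != 0 by rewrite -(inj_eq (@trmx_inj _ _ _)) trmxK trmx0.
by have := Sp _ vT; rewrite trmxK vS mul0mx mxE ltxx.
Qed.

Lemma psd_fnorm_le_tr (R : realType) n (A : 'M[R]_n) : psd A -> fnorm A <= \tr A.
Proof.
move=> Ap; have [Z [[Zs Zp] ZZ]] := psd_sqrt Ap.
rewrite -ZZ; apply: le_trans (ler_fnormM _ _) _.
by rewrite -expr2 fnorm_sqr Zs.
Qed.

(** With [G] the square root of [S], the norm of [G X G] is at most its trace [<S, X>]; undoing the
    two factors costs [|G^-1|^2]. *)
Lemma posdef_coercive (R : realType) n (S : 'M[R]_n) : posdef S ->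
  exists2 c, 0 <= c & forall X, psd X -> fnorm X <= c * \tr (S *m X).
Proof.
move=> Sp; have [G [[Gs Gp] GG]] := psd_sqrt (posdef_psd Sp).
have Gu : G \in unitmx.
  by have := posdef_unit Sp; rewrite -GG unitmx_mul => /andP[].
exists (fnorm (invmx G) * fnorm (invmx G)); first by rewrite mulr_ge0 ?fnorm_ge0.
move=> X Xp.
have XE : X = invmx G *m (G *m X *m G) *m invmx G.
  by rewrite !mulmxA mulVmx// mul1mx -mulmxA mulmxV// mulmx1.
have trE : \tr (S *m X) = \tr (G *m X *m G).
  by rewrite -GG -mulmxA mxtrace_mulC.
have Wp : psd (G *m X *m G) by rewrite -{1}Gs; exact: psd_congr.
have W_le := psd_fnorm_le_tr Wp.
rewrite [in leLHS]XE trE; apply: le_trans (ler_fnormM _ _) _.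
rewrite mulrAC ler_wpM2r ?fnorm_ge0//.
apply: le_trans (ler_fnormM _ _) _.
by rewrite ler_wpM2l ?fnorm_ge0.
Qed.

Lemma nonneg_slope (R : realType) (a b : R) :
  (forall t, 0 < t <= 1 -> 0 <= t * (2 * a) + t ^+ 2 * b) -> 0 <= a.
Proof.
move=> h; rewrite leNgt; apply/negP => a0.
have den : 0 < `|b| - a + 1 by have := normr_ge0 b; lra.
(* Chosen so that [t <= 1] and [t |b| <= - a], whence [2 a + t b <= a < 0]. *)
pose t := - a / (`|b| - a + 1).
have t0 : 0 < t by rewrite divr_gt0//; lra.
have t1 : t <= 1 by rewrite ler_pdivrMr//; have := normr_ge0 b; lra.
have := h t; rewrite t0 t1 => /(_ isT).
have -> : t * (2 * a) + t ^+ 2 * b = t * (2 * a + t * b) by ring.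
rewrite pmulr_rge0//.
have : t * b <= t * `|b| by rewrite ler_pM2l// ler_norm.
have : t * `|b| <= - a.
  rewrite /t mulrAC ler_pdivrMr//; have := normr_ge0 b; nra.
lra.
Qed.

Section Duality.
Variables (R : realType) (n m : nat) (D : sdp R n m) (eps : R).
Hypothesis As : forall i, (conA D i)^T = conA D i.
Hypothesis Cs : (cost D eps)^T = cost D eps.

Lemma primal_dual_gap X (y : 'cV[R]_m) (S : 'M[R]_n) :
  (forall i, inner (conA D i) X = conb D i 0) ->
  \sum_i y i 0 *: conA D i + S = cost D eps ->
  inner (cost D eps) X = dual_obj D y + inner S X.
Proof.
move=> AX <-; rewrite /inner mulmxDl linearD /= mulmx_suml linear_sum /=; congr (_ + _).
by apply: eq_bigr => i _; rewrite -scalemxAl linearZ /= -/(inner _ _) AX mulrC.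
Qed.

Lemma weak_duality X y S : primal_feasible D eps X -> dual_feasible D eps y S ->
  dual_obj D y <= inner (cost D eps) X.
Proof.
move=> [Xp AX] [Sp Sy]; rewrite (primal_dual_gap AX Sy) lerDl.
exact: psd_tr_mul_ge0.
Qed.

(* The dual solution is read off the minimizer over the psd cone of the penalty
   pen X = |A X - b|^2 + max(0, <C, X> - q)^2, which is positive because q is below
   the optimal value; strict dual feasibility makes pen coercive. *)
Section Approx.
Variables (ybar : 'cV[R]_m) (Sbar : 'M[R]_n).
Hypotheses (hSbar : dual_feasible D eps ybar Sbar) (pSbar : posdef Sbar).
Variables (Xc : 'M[R]_n) (q : R).
Hypotheses (hXc : primal_opt D eps Xc) (hq : q < inner (cost D eps) Xc).

Let res i (X : 'M[R]_n) : R := inner (conA D i) X - conb D i 0.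
Let exc X : R := Num.max 0 (inner (cost D eps) X - q).
Let pen X : R := \sum_i res i X ^+ 2 + exc X ^+ 2.

Let pen_continuous : continuous pen.
Proof.
have resc i : continuous (res i).
  move=> X; apply: continuousB; [exact: mxtrace_mul_continuous|exact: cst_continuous].
have excc : continuous exc.
  move=> X; apply: (continuous_max (f := fun=> 0)
    (g := fun Z => inner (cost D eps) Z - q)); first exact: cst_continuous.
  by apply: continuousB; [exact: mxtrace_mul_continuous|exact: cst_continuous].
have sq (g : 'M[R]_n -> R) : continuous g -> continuous (fun X => g X ^+ 2).
  move=> gc X; rewrite (_ : (fun X => g X ^+ 2) = g \* g).
    by apply: continuousM; exact: gc.
  by apply/funext => Z; rewrite expr2.
move=> X; apply: (continuousD (f := fun Z => \sum_i res i Z ^+ 2)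
  (g := fun Z => exc Z ^+ 2)); last exact: sq.
by apply: continuous_sum => i; exact/sq/resc.
Qed.

(** It suffices to minimize over the sublevel set through [Xc]. There the penalty controls the
    residuals and the excess, hence bounds [<Sbar, X>] from above, hence bounds [X]. *)
Lemma penalty_min : exists2 X, psd X & forall Z, psd Z -> pen X <= pen Z.
Proof.
have [c c0 cX] := posdef_coercive pSbar.
pose F := pen Xc; pose K := [set X | psd X /\ pen X <= F].
have t_le (t : R) : t <= 1 + t ^+ 2 by have := sqr_ge0 (t - 1); have := sqr_ge0 t; nra.
have Kb X : K X -> fnorm X <=
    c * (q + (1 + F) + \sum_i `|ybar i 0| * (`|conb D i 0| + (1 + F))).
  move=> [Xp XF]; apply: le_trans (cX _ Xp) _; apply: ler_wpM2l => //.
  have r_le i : `|res i X| <= 1 + F.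
    apply: le_trans (t_le _) _; rewrite lerD2l real_normK ?num_real//.
    apply: le_trans XF; rewrite /pen (bigD1 i)//= -addrA lerDl addr_ge0 ?sqr_ge0//.
    by apply: sumr_ge0 => ? _; exact: sqr_ge0.
  have e_le : inner (cost D eps) X - q <= 1 + F.
    apply: le_trans (_ : exc X <= _); first by rewrite /exc le_max lexx orbT.
    apply: le_trans (t_le _) _; rewrite lerD2l; apply: le_trans XF.
    by rewrite lerDr sumr_ge0// => ? _; exact: sqr_ge0.
  have -> : \tr (Sbar *m X) = inner (cost D eps) X -
      \sum_i ybar i 0 * inner (conA D i) X.
    rewrite -hSbar.2 /inner mulmxDl linearD /= mulmx_suml linear_sum /=.
    rewrite addrAC -sumrB big1 ?add0r// => i _.
    by rewrite -scalemxAl linearZ subrr.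
  apply: lerD; first by lra.
  rewrite -sumrN; apply: ler_sum => i _.
  apply: le_trans (ler_norm _) _; rewrite normrN normrM ler_wpM2l//.
  rewrite -[inner _ _](subrK (conb D i 0)) addrC.
  by apply: le_trans (ler_normD _ _) _; rewrite lerD2l; exact: r_le.
have K0 : K !=set0 by exists Xc; split; [exact: hXc.1.1 | rewrite /F].
have Kc : closed K.
  apply: closedI; first exact: psd_closed.
  by apply: ((continuous_closedP pen).1 _ [set t | t <= F]); last exact: closed_le.
have [X [Xp _] Xmin] := mx_compact_min K0 Kc Kb pen_continuous.
exists X => // Z Zp; have [ZF|/ltW ZF] := leP (pen Z) F; first exact: Xmin.
by apply: le_trans ZF; apply: Xmin; split; [exact: hXc.1.1 | rewrite /F].
Qed.

(** [H] is half the gradient of the penalty at its minimizer [X]. Optimality over the cone makes [H]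
    positive semidefinite with [<H, X> <= 0]; divided by [tau] it becomes a dual slack. *)
Lemma approx_dual : exists y S, dual_feasible D eps y S /\ q < dual_obj D y.
Proof.
have [X Xp Xmin] := penalty_min.
pose tau := exc X; pose H := tau *: cost D eps + \sum_i res i X *: conA D i.
have HE Z : inner H Z = tau * inner (cost D eps) Z + \sum_i res i X * inner (conA D i) Z.
  rewrite /inner /H mulmxDl linearD /= -scalemxAl linearZ /= mulmx_suml linear_sum /=.
  by congr (_ + _); apply: eq_bigr => i _; rewrite -scalemxAl linearZ.
have tau0 : 0 <= tau by rewrite /tau /exc le_max lexx.
have slope Z : (forall t, 0 < t <= 1 -> psd (X + t *: Z)) -> 0 <= inner H Z.
  move=> Zp; pose B := \sum_i inner (conA D i) Z ^+ 2 + inner (cost D eps) Z ^+ 2.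
  apply: (@nonneg_slope _ _ B) => t t01.
  have innD A : inner A (X + t *: Z) = inner A X + t * inner A Z.
    by rewrite /inner mulmxDr linearD /= -scalemxAr linearZ.
  have : pen (X + t *: Z) <= pen X + (t * (2 * inner H Z) + t ^+ 2 * B).
    (* The squared positive part is bounded by a quadratic with the same value and slope at [t = 0],
       so the maximum is never differentiated. *)
    have exc_le : exc (X + t *: Z) ^+ 2 <= (tau + t * inner (cost D eps) Z) ^+ 2.
      rewrite /tau /exc innD; set u := inner _ X; set v := t * _.
      rewrite /Num.max; case: (ltP 0 (u + v - q)) => uvq; last by rewrite expr0n sqr_ge0.
      case: (ltP 0 (u - q)) => uq; first by rewrite addrAC.
      by rewrite add0r ler_pXn2r// ?nnegrE; lra.
    have -> : pen X + (t * (2 * inner H Z) + t ^+ 2 * B) =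
       \sum_i (res i X + t * inner (conA D i) Z) ^+ 2
         + (tau + t * inner (cost D eps) Z) ^+ 2.
      rewrite HE /B /pen -/tau.
      have -> : \sum_i (res i X + t * inner (conA D i) Z) ^+ 2 =
          \sum_i res i X ^+ 2 + (2 * t * \sum_i res i X * inner (conA D i) Z
            + t ^+ 2 * \sum_i inner (conA D i) Z ^+ 2).
        by rewrite !mulr_sumr -!big_split /=; apply: eq_bigr => i _; ring.
      ring.
    rewrite /pen; apply: lerD => //; rewrite le_eqVlt; apply/orP; left; apply/eqP.
    by apply: eq_bigr => i _; rewrite /res innD addrAC.
  by have := Xmin _ (Zp _ t01); lra.
have Hs : H^T = H.
  rewrite /H linearD /= linearZ /= Cs linear_sum /=; congr (_ + _).
  by apply: eq_bigr => i _; rewrite linearZ /= As.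
have Hp : psd H.
  split=> // x.
  have -> : (x^T *m H *m x) 0 0 = inner H (x *m x^T).
    by rewrite quad_trE mxtrace_mulC mulmxA mxtrace_mulC.
  apply: slope => t /andP[/ltW t0 _]; apply: psdD => //; apply: psdZ => //.
  split; first by rewrite trmx_mul trmxK.
  move=> z; have -> : z^T *m (x *m x^T) *m z = (x^T *m z)^T *m (x^T *m z).
    by rewrite trmx_mul trmxK !mulmxA.
  by rewrite -fnorm_cV_sqr sqr_ge0.
(* Shrinking [X] is an admissible direction too. *)
have HX : inner H X <= 0.
  have : 0 <= inner H (- X).
    apply: slope => t /andP[_ t1]; rewrite scalerN -[X in psd (X - _)]scale1r -scalerBl.
    by apply: psdZ => //; rewrite subr_ge0.
  by rewrite /inner mulmxN linearN oppr_ge0.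
have tauE : tau * inner (cost D eps) X = tau * q + tau ^+ 2.
  rewrite /tau /exc /Num.max; case: ltP => _; ring.
(* A vanishing penalty would make [X] feasible with value at most [q], below the optimum. *)
have penX : 0 < pen X.
  have pen0 : 0 <= pen X.
    by rewrite addr_ge0 ?sqr_ge0// sumr_ge0// => ? _; exact: sqr_ge0.
  rewrite lt_neqAle pen0 andbT eq_sym; apply/negP => /eqP penX0.
  have sum0 : \sum_i res i X ^+ 2 = 0.
    apply/eqP; rewrite eq_le sumr_ge0 ?andbT => [|? _]; last exact: sqr_ge0.
    by have := sqr_ge0 (exc X); move: penX0; rewrite /pen; lra.
  have exc0 : exc X = 0.
    by apply/eqP; rewrite -sqrf_eq0; move: penX0; rewrite /pen sum0 add0r => /eqP.
  have resX i : inner (conA D i) X = conb D i 0.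
    apply/eqP; rewrite -subr_eq0 -/(res i X) -sqrf_eq0.
    by rewrite (psumr_eq0P (fun i _ => sqr_ge0 (res i X)) sum0).
  have := hXc.2 X (conj Xp resX).
  have : inner (cost D eps) X - q <= exc X by rewrite /exc le_max lexx orbT.
  rewrite exc0; move: hq; lra.
pose wb := \sum_i res i X * conb D i 0.
(* [<H, X>] is [tau * q + wb] plus the positive penalty. *)
have key : tau * q + wb < 0.
  have : inner H X = tau * q + wb + pen X.
    rewrite HE tauE /pen -/tau.
    have -> : \sum_i res i X * inner (conA D i) X = wb + \sum_i res i X ^+ 2.
      rewrite /wb -big_split /=; apply: eq_bigr => i _; rewrite /res; ring.
    ring.
  move: HX penX; lra.
(* For [tau = 0] the product [<H, Xc>] would be [wb < 0], against positive semidefiniteness. *)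
have tau_gt0 : 0 < tau.
  rewrite lt_neqAle tau0 andbT eq_sym; apply/negP => /eqP tau_0.
  have : inner H Xc = wb.
    rewrite HE tau_0 mul0r add0r; apply: eq_bigr => i _.
    by rewrite hXc.1.2.
  have : 0 <= inner H Xc by apply: psd_tr_mul_ge0 => //; exact: hXc.1.1.
  move: key; rewrite tau_0; lra.
exists (\col_i (- (res i X / tau))), (tau^-1 *: H); split; first split.
- by apply: psdZ => //; rewrite invr_ge0.
- rewrite /H scalerDr scalerA mulVf ?gt_eqF// scale1r addrCA scaler_sumr -big_split /=.
  rewrite big1 ?addr0// => i _; rewrite mxE scalerA mulrC scaleNr addNr //.
- rewrite /dual_obj (eq_bigr (fun i => - tau^-1 * (res i X * conb D i 0))).
    by rewrite -mulr_sumr -/wb mulNr -mulrN mulrC ltr_pdivlMr//; move: key; lra.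
  by move=> i _; rewrite mxE; ring.
Qed.

End Approx.

(** A positive gap would put the dual optimal value strictly below the primal one, and [approx_dual]
    with that value as [q] would yield a better dual point. *)
Lemma strong_duality ybar Sbar Xc yc Sc :
  dual_feasible D eps ybar Sbar -> posdef Sbar ->
  primal_opt D eps Xc -> dual_opt D eps (yc, Sc) -> inner Sc Xc = 0.
Proof.
move=> hS pS hX [[/= Scp Scy] hy].
have gap := primal_dual_gap hX.1.2 Scy.
have ge0 : 0 <= inner Sc Xc by apply: psd_tr_mul_ge0 => //; exact: hX.1.1.
apply/eqP; rewrite eq_le ge0 andbT leNgt; apply/negP => gt0.
have [|y [S [Sf yq]]] := @approx_dual ybar Sbar hS pS Xc (dual_obj D yc) hX.
  by rewrite gap ltrDl.
by have := hy _ _ Sf; rewrite leNgt yq.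
Qed.

End Duality.

(** * The optimal faces *)

(** An off-diagonal pair contributes twice to the trace; the two factors [sqrt 2] account for
    this. *)
Lemma svec_inner (R : realType) n (X Y : 'M[R]_n) : X^T = X -> Y^T = Y ->
  ((svec X)^T *m svec Y) 0 0 = inner X Y.
Proof.
move=> Xs Ys; pose a (i j : 'I_n) := X i j * Y i j.
have aC i j : a i j = a j i by rewrite /a -{1}Xs -{1}Ys !mxE.
have -> : inner X Y = \sum_(p : 'I_n * 'I_n) a p.1 p.2.
  by rewrite /inner -{1}Xs mxtrace_mulTmx pair_bigA.
rewrite (bigID (upper n)) /=.
have -> : \sum_(p : 'I_n * 'I_n | ~~ (p.1 <= p.2)%N) a p.1 p.2 =
          \sum_(p : 'I_n * 'I_n | (p.1 <= p.2)%N) (if p.1 == p.2 then 0 else a p.1 p.2).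
  rewrite (reindex_inj (h := fun p : 'I_n * 'I_n => (p.2, p.1))) /=; last first.
    by move=> [? ?] [? ?] [-> ->].
  rewrite [RHS](bigID (fun p : 'I_n * 'I_n => p.1 == p.2)) /= [X in _ = X + _]big1.
    rewrite add0r; apply: eq_big => [[i j]|[i j] /= ij].
      by rewrite /= -ltnNge ltn_neqAle andbC.
    by rewrite aC; case: eqP ij => // ->; rewrite leqnn.
  by move=> p /andP[_ ->].
rewrite -big_split /=; transitivity (\sum_(p in upper n)
    (a p.1 p.2 + (if p.1 == p.2 then 0 else a p.1 p.2))); last exact: eq_bigl.
rewrite big_enum_val mxE; apply: eq_bigr => k _; rewrite !mxE /=.
case: eqP => _; first by rewrite addr0.
have s2 : Num.sqrt 2 * Num.sqrt 2 = 2 :> R by rewrite -expr2 sqr_sqrtr.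
by rewrite mulrACA s2 /a; ring.
Qed.

Lemma svec_inj (R : realType) n (X Y : 'M[R]_n) : X^T = X -> Y^T = Y ->
  svec X = svec Y -> X = Y.
Proof.
move=> Xs Ys e; apply/eqP; rewrite -subr_eq0; apply/eqP; apply: fnorm_eq0.
have Zs : (X - Y)^T = X - Y by rewrite linearB /= Xs Ys.
apply/eqP; rewrite -sqrf_eq0 fnorm_sqr Zs -[\tr _]/(inner (X - Y) (X - Y)) -svec_inner//.
have -> : svec (X - Y) = 0.
  apply/colP => k; have := congr1 (fun v : 'cV_#|upper n| => v k 0) e.
  rewrite !mxE /=; case: eqP => _ XY; first by rewrite !mxE XY subrr.
  by rewrite !mxE mulrBr XY subrr.
by rewrite mulmx0 mxE.
Qed.

Section Faces.
Variables (R : realType) (n m : nat) (D : sdp R n m) (eps : R).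
Hypothesis As : forall i, (conA D i)^T = conA D i.
Variables (Xc : 'M[R]_n) (yc : 'cV[R]_m) (Sc : 'M[R]_n).
Hypotheses (hXc : primal_opt D eps Xc) (hSc : dual_opt D eps (yc, Sc)).
Hypothesis gap0 : inner Sc Xc = 0.

Let Xs : Xc^T = Xc. Proof. by case: hXc => -[[]]. Qed.
Let Ss : Sc^T = Sc. Proof. by case: hSc => -[[]]. Qed.

Lemma svecA_mul i (X : 'M[R]_n) : X^T = X -> (svecA D *m svec X) i 0 = inner (conA D i) X.
Proof.
move=> XX; rewrite -svec_inner// !mxE; apply: eq_bigr => k _; rewrite [svecA _ _ _]mxE.
by rewrite [in RHS]mxE.
Qed.

(** Since [Z] is orthogonal to [Sc], its cost equals the objective of [yc], a lower bound by weak
    duality. *)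
Lemma LbarP_opt Z : psd Z -> LbarP D Xc Sc (svec Z) -> primal_opt D eps Z.
Proof.
move=> Zp [AZ SZ]; have Zs := Zp.1.
have AZ' i : inner (conA D i) Z = conb D i 0.
  rewrite -hXc.1.2 -!svecA_mul//; apply/eqP; rewrite -subr_eq0; apply/eqP.
  have := congr1 (fun v : 'cV_m => v i 0) AZ; rewrite mulmxBr [RHS]mxE => h.
  by rewrite -[RHS]h [RHS]mxE; congr (_ + _); rewrite [RHS]mxE.
have SZ' : inner Sc Z = 0 by rewrite -svec_inner// SZ mxE.
split=> // X' fX'.
have Scy := hSc.1.2.
by rewrite (primal_dual_gap AZ' Scy) SZ' addr0 (weak_duality fX' hSc.1).
Qed.

(** Makes the face nonempty, so that the infimum defining the distance to it is not a default
    value. *)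
Lemma LbarP_self : LbarP D Xc Sc (svec Xc).
Proof.
split; first by rewrite subrr mulmx0.
by apply/matrixP => i j; rewrite !ord1 svec_inner// gap0 mxE.
Qed.

Lemma LbarD_opt Z : psd Z -> LbarD D Xc Sc (svec Z) ->
  exists y, dual_opt D eps (y, Z).
Proof.
move=> Zp [[w Zw] XZ]; have Zs := Zp.1.
have XZ' : inner Z Xc = 0 by rewrite /inner mxtrace_mulC -[LHS]/(inner Xc Z) -svec_inner// XZ mxE.
have ZE : Z = Sc + \sum_i w i 0 *: conA D i.
  apply: svec_inj => //.
    rewrite linearD /= Ss linear_sum /=; congr (_ + _).
    by apply: eq_bigr => i _; rewrite linearZ /= As.
  pose c (k : 'I_#|upper n|) : R :=
    if (enum_val k).1 == (enum_val k).2 then 1 else Num.sqrt 2.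
  have svE (X : 'M[R]_n) k : svec X k 0 = c k * X (enum_val k).1 (enum_val k).2.
    by rewrite mxE /= /c; case: eqP => _; rewrite ?mul1r.
  rewrite Zw; apply/colP => k; rewrite [LHS]mxE [X in _ + X]mxE !svE.
  rewrite [in RHS]mxE mulrDr summxE mulr_sumr; congr (_ + _).
  by apply: eq_bigr => i _; rewrite [X in X * _]mxE [X in X * _]mxE svE mxE mulrAC mulrA.
(* The change of the slack along [w] is compensated by the multipliers. *)
exists (yc - w).
have fZ : dual_feasible D eps (yc - w) Z.
  split=> //; rewrite {1}ZE -hSc.1.2 [Sc + _]addrC addrA -big_split /=; congr (_ + _).
  by apply: eq_bigr => i _; rewrite !mxE -scalerDl subrK.
split=> // y' S' f' /=.
apply: le_trans (weak_duality hXc.1 f') _.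
by rewrite (primal_dual_gap hXc.1.2 fZ.2) XZ' addr0.
Qed.

Lemma LbarD_self : LbarD D Xc Sc (svec Sc).
Proof.
split; first by exists 0; rewrite mulmx0 addr0.
apply/matrixP => i j; rewrite !ord1 svec_inner// mxE.
by rewrite /inner mxtrace_mulC.
Qed.

End Faces.

(** * Relative interiors and the supports of optimal solutions *)

Lemma relint_extend (R : realType) (V : normedModType R) (K : set V) (x x' : V) :
  relint K x -> K x' -> exists2 t, 0 < t & K (x + t *: (x - x')).
Proof.
move=> [Kx /nbhs_normP[e /= e0 eK]] Kx'.
(* The added 1 keeps the divisor of the step length positive when the two points coincide. *)
pose d := 1 + `|x - x'|; have d0 : 0 < d by rewrite ltr_pwDl.
exists (e / 2 / d); first by rewrite !divr_gt0.
set t := e / 2 / d; apply: eK.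
  rewrite /ball_ /= opprD addNKr normrN normrZ ger0_norm ?divr_ge0 ?(ltW e0) ?(ltW d0)//.
  have Nd : `|x - x'| / d <= 1 by rewrite ler_pdivrMr// mul1r lerDr.
  have -> : t * `|x - x'| = e / 2 * (`|x - x'| / d) by rewrite /t; ring.
  by apply: le_lt_trans (ler_wpM2l _ Nd) _; lra.
(* The extended point is the affine combination with weights [1 + t] and [- t]. *)
exists 2, (fun i => if i == 0 then x else x'), (fun i => if i == 0 then 1 + t else - t).
split; first by move=> i; case: ifP.
  by rewrite !big_ord_recl big_ord0 /= addr0 addrK.
by rewrite !big_ord_recl big_ord0 /= addr0 scalerDl scale1r scalerBr scaleNr addrA.
Qed.

(** On the kernel of [X] the form of the extended point is [- t] times that of [X']; both being
    nonnegative, they vanish. *)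
Lemma psd_extend_ker (R : realType) n (X X' : 'M[R]_n) t (u : 'cV[R]_n) :
  0 < t -> psd X' -> psd (X + t *: (X - X')) -> X *m u = 0 -> X' *m u = 0.
Proof.
move=> t0 X'p [_ /(_ u)] h Xu; apply: psd_quad0 => //; apply/eqP.
rewrite eq_le X'p.2 andbT; move: h.
have -> : (u^T *m (X + t *: (X - X')) *m u) 0 0 = - (t * (u^T *m X' *m u) 0 0).
  rewrite -mulmxA mulmxDl Xu add0r -scalemxAl mulmxBl Xu sub0r scalerN mulmxN.
  by rewrite -scalemxAr mulmxA !mxE.
by rewrite oppr_ge0 pmulr_rle0.
Qed.

(** The columns of [1 - Q *m Q^T] lie in the kernel of [X], hence in that of [X']. *)
Lemma orthonormal_supp (R : realType) n k (Q : 'M[R]_(n, k)) (X X' : 'M[R]_n) :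
  orthonormal_basis Q (colspace X) -> X^T = X ->
  (forall u : 'cV[R]_n, X *m u = 0 -> X' *m u = 0) -> X' *m (Q *m Q^T) = X'.
Proof.
move=> [QQ QX] Xs ker.
have /submxP[C XC] : (X <= Q^T)%MS.
  by rewrite -(genmxE Q^T) -/(colspace Q) QX genmxE Xs.
have X0 : X *m (1%:M - Q *m Q^T) = 0.
  by rewrite mulmxBr mulmx1 XC -!mulmxA (mulmxA Q^T) QQ mul1mx subrr.
have : X' *m (1%:M - Q *m Q^T) = 0.
  apply/matrixP => i j; rewrite [RHS]mxE.
  have h : X *m (1%:M - Q *m Q^T) *m (delta_mx j 0 : 'cV[R]_n) = 0 by rewrite X0 mul0mx.
  move: h; rewrite -mulmxA => /ker; rewrite mulmxA -colE.
  by move/(congr1 (fun v : 'cV_n => v i 0)); rewrite [LHS]mxE => ->; rewrite mxE.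
by rewrite mulmxBr mulmx1 => /eqP; rewrite subr_eq0 => /eqP.
Qed.

Lemma orthonormal_basis_rank (R : realType) n k (Q : 'M[R]_(n, k)) (U : 'M[R]_n) :
  orthonormal_basis Q U -> \rank U = k.
Proof.
move=> [QQ <-]; rewrite genmxE; apply/eqP; rewrite -/(row_free _); apply/row_freeP.
by exists Q.
Qed.

Lemma max_compl_mc_sol (R : realType) n m (D : sdp R n m) (J : set R) e :
  fixed_dim_varying_partition D J -> J e -> max_compl D e (mc_sol D e).
Proof.
move=> [_ _ _ rk [e1 [e2 [J1 J2 neq]]]] Je.
have [ex|nex] := pselect (exists z, max_compl D e z); first exact: xgetPex.
(* Otherwise mc_sol is the junk value 0, so all the ranks, hence all the subspaces,
   vanish on J and the partition cannot vary. *)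
have mc0 : mc_sol D e = 0.
  by apply: xgetPN => z hz; apply: nex; exists z.
have sp0 e' : J e' -> spB D e' = 0 /\ spN D e' = 0.
  move=> Je'; have [rB rN] := rk _ _ Je' Je.
  by split; apply/eqP; rewrite -mxrank_eq0 ?rB ?rN /spB /spN mc0 genmxE linear0 mxrank0.
case: neq; rewrite /opt_partition /spT.
by have [-> ->] := sp0 _ J1; have [-> ->] := sp0 _ J2.
Qed.

(** * The spectral gap of the central solutions *)

Section CentralEigenvalues.
Variables (R : realType) (n k l : nat) (mu : R) (X S : 'M[R]_n).
Variables (Q1 : 'M[R]_(n, k)) (Q2 : 'M[R]_(n, l)) (x1 : 'rV[R]_k) (x2 : 'rV[R]_l).
Hypotheses (hX : eigen_split X Q1 Q2 x1 x2) (mu0 : 0 < mu).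
Hypotheses (Xp : psd X) (Sp : psd S) (SX : S *m X = mu%:M).

(** A zero eigenvalue would annihilate a diagonal entry of [Q^T S X Q], all of which equal [mu]. *)
Lemma central_eigenvalue_gt0 p (Q : 'M[R]_(n, p)) (x : 'rV[R]_p) i :
  Q^T *m Q = 1%:M -> X *m Q = Q *m diag_mx x -> 0 < x 0 i.
Proof.
move=> QQ XQ; rewrite lt_neqAle eq_sym; apply/andP; split.
  apply/negP => /eqP xi0.
  have : (Q^T *m S *m Q *m diag_mx x) i i = mu.
    rewrite -mulmxA -XQ !mulmxA -(mulmxA Q^T) SX mul_mx_scalar -scalemxAl QQ.
    by rewrite !mxE eqxx mulr1.
  rewrite mul_mx_diag mxE xi0 mulr0 => mu_0; move: mu0; rewrite -mu_0 ltxx //.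
have := psd_diag_ge0 i (psd_congr Q Xp).
by rewrite -mulmxA XQ mulmxA QQ mul1mx mxE eqxx.
Qed.

Lemma central_dual_eigen p (Q : 'M[R]_(n, p)) (x : 'rV[R]_p) :
  Q^T *m Q = 1%:M -> X *m Q = Q *m diag_mx x ->
  S *m Q = Q *m diag_mx (\row_i (mu / x 0 i)).
Proof.
move=> QQ XQ.
have xx : diag_mx x *m diag_mx (\row_i (x 0 i)^-1) = 1%:M.
  rewrite mulmx_diag -diag_const_mx; congr diag_mx; apply/rowP => i; rewrite !mxE.
  by rewrite divff// gt_eqF// (central_eigenvalue_gt0 i QQ XQ).
rewrite -[LHS]mulmx1 -xx mulmxA -(mulmxA S) -XQ mulmxA SX mul_scalar_mx -scalemxAl scalemxAr.
by congr (_ *m _); apply/matrixP => i j; rewrite !mxE mulrnAr.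
Qed.

(* Some nonzero vector of the range of Q0 has all its Q1-coordinates but the i-th
   equal to 0; the Rayleigh quotient of S at this vector is at least mu / x1 i. *)
Lemma large_eigenvalue_bound (Q0 : 'M[R]_(n, k)) (W : 'M[R]_n) i :
  Q0^T *m Q0 = 1%:M -> psd W -> W *m (Q0 *m Q0^T) = W ->
  \tr (W *m S) <= n%:R * mu ->
  lambda_min (Q0^T *m W *m Q0) <= n%:R * x1 0 i.
Proof.
move=> QQ Wp WQ trW; have [[q11 q22 q12 q] m1 m2 le21] := hX.
have x1_gt0 j := central_eigenvalue_gt0 j q11 m1.
have x2_gt0 j := central_eigenvalue_gt0 j q22 m2.
set U := Q0^T *m W *m Q0; set la := lambda_min U.
have [la_le0|la_gt0] := leP la 0.
  by apply: le_trans la_le0 _; rewrite mulr_ge0// ltW.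
have Up : psd U by exact: psd_congr.
pose G := Q0^T *m S *m Q0; have Gp : psd G by exact: psd_congr.
have WE : W = Q0 *m U *m Q0^T.
  rewrite /U -{1}WQ -{1}[W]Wp.1 -{1}WQ !trmx_mul trmxK Wp.1 !mulmxA //.
have trG : la * \tr G <= n%:R * mu.
  apply: le_trans trW; rewrite {1}WE.
  have -> : \tr (Q0 *m U *m Q0^T *m S) = \tr (U *m G).
    by rewrite -!mulmxA mxtrace_mulC /G !mulmxA.
  have := psdB_tr_le (lambda_minP Up.1).1 Gp.
  by rewrite mul_scalar_mx linearZ.
have [x x_neq0 xQ] := exists_ker_row' (Q1^T *m Q0) i.
pose u := Q0 *m x.
have uu : (u^T *m u) 0 0 = (x^T *m x) 0 0.
  by rewrite trmx_mul -mulmxA (mulmxA Q0^T) QQ mul1mx.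
have u_gt0 : 0 < (u^T *m u) 0 0 by rewrite uu norm_cV_gt0.
(* Inversion reverses the order of positive eigenvalues, so the same splitting is ordered correctly
   for [- S]. *)
have hS : eigen_split (- S) Q1 Q2 (- \row_j (mu / x1 0 j)) (- \row_j (mu / x2 0 j)).
  split=> // [||a b]; first by rewrite mulNmx (central_dual_eigen q11 m1) linearN /= mulmxN.
    by rewrite mulNmx (central_dual_eigen q22 m2) linearN /= mulmxN.
  by rewrite !mxE lerN2 ler_pM2l// lef_pV2// posrE.
have Su : mu / x1 0 i * (u^T *m u) 0 0 <= (u^T *m S *m u) 0 0.
  have : (u^T *m (- S) *m u) 0 0 <= - (mu / x1 0 i) * (u^T *m u) 0 0.
    apply: eigen_split_quad_le hS _ _ => j; rewrite ?mulmxA.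
      by move=> /xQ ->; rewrite !mxE.
    by move=> _; rewrite !mxE lerN2 ler_pM2l// lef_pV2// posrE.
  by rewrite mulmxN mulNmx mulNr mxE lerN2.
have Gu : (u^T *m S *m u) 0 0 <= \tr G * (u^T *m u) 0 0.
  have -> : (u^T *m S *m u) 0 0 = (x^T *m G *m x) 0 0 by rewrite /G trmx_mul !mulmxA.
  rewrite uu; apply: le_trans (ler_norm _) _; apply: le_trans (quad_le_fnorm _ _) _.
  by rewrite ler_pM2r -?uu// psd_fnorm_le_tr.
have : mu / x1 0 i <= \tr G by rewrite -(ler_pM2r u_gt0); exact: le_trans Gu.
rewrite -(ler_pM2l la_gt0) => /le_trans /(_ trG).
by rewrite mulrCA mulrC ler_pM2r// ler_pdivrMr.
Qed.

(* The span of Q1 and the j-th column of Q2 has dimension k + 1, hence meets the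
   orthogonal of the range of Q0 in a nonzero vector; Z vanishes there. *)
Lemma small_eigenvalue_bound (Q0 : 'M[R]_(n, k)) (Z : 'M[R]_n) j :
  Z *m (Q0 *m Q0^T) = Z -> x2 0 j <= fnorm (X - Z).
Proof.
move=> ZQ; have [[q11 q22 q12 q] m1 m2 le21] := hX.
pose B := row_mx Q1 (col j Q2).
have BB : B^T *m B = 1%:M.
  have c12 : Q1^T *m col j Q2 = 0 by rewrite colE mulmxA q12 mul0mx.
  have c21 : (col j Q2)^T *m Q1 = 0 by rewrite -[LHS]trmxK trmx_mul trmxK c12 trmx0.
  have c22 : (col j Q2)^T *m col j Q2 = 1%:M.
    rewrite colE trmx_mul -mulmxA (mulmxA Q2^T) q22 mul1mx trmx_delta mul_delta_mx.
    by apply/matrixP => a b; rewrite !ord1 !mxE !eqxx.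
  by rewrite tr_row_mx mul_col_row q11 c12 c21 c22 -scalar_mx_block.
have [|x x_neq0 xQ] := @exists_ker R _ _ (Q0^T *m B); first by rewrite addn1.
pose u := B *m x.
have uu : (u^T *m u) 0 0 = (x^T *m x) 0 0.
  by rewrite trmx_mul -mulmxA (mulmxA B^T) BB mul1mx.
have u_gt0 : 0 < (u^T *m u) 0 0 by rewrite uu norm_cV_gt0.
have Zu : Z *m u = 0 by rewrite -ZQ /u -!mulmxA (mulmxA Q0^T) xQ !mulmx0.
have lo : x2 0 j * (u^T *m u) 0 0 <= (u^T *m X *m u) 0 0.
  apply: eigen_split_quad_ge hX _ _ => [a _|a]; first exact: le21.
  have [->//|aj] := eqVneq a j.
  rewrite /u /B mulmxA mul_mx_row -[Q2^T *m Q1]trmxK trmx_mul trmxK q12 trmx0.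
  rewrite colE mulmxA q22 mul1mx -[x]vsubmxK mul_row_col mul0mx add0r.
  by rewrite mxE big_ord1 !mxE (negbTE aj) mul0r eqxx.
rewrite -(ler_pM2r u_gt0); apply: le_trans lo _.
have -> : (u^T *m X *m u) 0 0 = (u^T *m (X - Z) *m u) 0 0.
  by rewrite -!mulmxA mulmxBl Zu subr0.
exact: le_trans (ler_norm _) (quad_le_fnorm _ _).
Qed.

End CentralEigenvalues.

(** The first term of the threshold gives [c (n mu)^gamma < sigma / n^(3/2)]; then [sigma <= n a]
    and [n <= n^(3/2)] bound the right-hand side by [a]. *)
Lemma mutilde_lt (R : realType) n (sigma : \bar R) (t1 t2 c gamma mu a : R) :
  (0 < n)%N -> 0 < mu -> 0 < c -> 0 < gamma -> 0 <= a ->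
  (0 <= sigma)%E -> (sigma <= (n%:R * a)%:E)%E ->
  (mu%:E < mutilde n sigma t1 t2 c gamma)%E ->
  c * (n%:R * mu) `^ gamma < a /\ mu <= muhat n t1 t2.
Proof.
move=> n0 mu0 c0 g0 a0; case: sigma => // s; rewrite !lee_fin => s0 sa.
rewrite /mutilde !lt_min => /andP[/andP[h _] h2]; split; last first.
  by move: h2; rewrite lte_fin => /ltW.
have nR : 0 < n%:R :> R by rewrite ltr0n.
have np : 0 < n%:R `^ (3 / 2) :> R by rewrite powR_gt0.
move: h; rewrite -EFinM lte_fin.
set t := s * _; have t0 : 0 <= t by rewrite mulr_ge0// invr_ge0 mulr_ge0 ?ltW.
rewrite -ltr_pdivrMl ?invr_gt0// invrK => h.
have : (n%:R * mu) `^ gamma < t.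
  have -> : t = (t `^ gamma^-1) `^ gamma.
    by rewrite -powRrM mulVf ?gt_eqF// powRr1.
  by apply: gt0_ltr_powR => //; rewrite nnegrE ?powR_ge0// mulr_ge0 ?ltW.
rewrite -(ltr_pM2l c0) => /lt_le_trans; apply.
have -> : c * t = s / n%:R `^ (3 / 2).
  by rewrite /t; field; rewrite (gt_eqF c0) (gt_eqF np).
rewrite ler_pdivrMr//; apply: le_trans sa _; rewrite mulrC ler_wpM2l//.
have : n%:R `^ 1 <= n%:R `^ (3 / 2) :> R by apply: ler_powR; [rewrite ler1n|lra].
by rewrite powRr1// ltW.
Qed.

(** The optimal set and the face are abstract, so that the result applies to the primal side and,
    with [X] and [S] exchanged, to the dual side. *)
Lemma spectral_gap (R : realType) n k l (mu : R) (X S : 'M[R]_n)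
    (Q1 : 'M[R]_(n, k)) (Q2 : 'M[R]_(n, l)) x1 x2 (Q0 : 'M[R]_(n, k))
    (opt face : set 'M[R]_n) (sigma : \bar R) (theta1 theta2 c gamma : R) :
  eigen_split X Q1 Q2 x1 x2 -> 0 < mu -> psd X -> psd S -> S *m X = mu%:M ->
  Q0^T *m Q0 = 1%:M ->
  (forall W, opt W -> [/\ psd W, W *m (Q0 *m Q0^T) = W & \tr (W *m S) <= n%:R * mu]) ->
  face `<=` opt -> face !=set0 ->
  (0 <= sigma)%E ->
  (forall a : R, (0 < k)%N -> (forall W, opt W -> lambda_min (Q0^T *m W *m Q0) <= a) ->
    (sigma <= a%:E)%E) ->
  0 < c -> 2 `^ (1 - n%:R) <= gamma ->
  (mu <= muhat n theta1 theta2 -> setdist X face <= c * (n%:R * mu) `^ gamma) ->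
  (mu%:E < mutilde n sigma theta1 theta2 c gamma)%E ->
  (0 < k)%N -> lambda k.+1 X < lambda k X.
Proof.
move=> hX mu0 Xp Sp SX QQ hopt sub face0 sig0 hsig c0 gam hdist hmu k0.
have [q m1 _ _] := hX; have [q11 _ _ _] := q.
have [i ->] := lambda_split_attained1 hX k0.
have xi0 : 0 < x1 0 i by exact: central_eigenvalue_gt0 mu0 Xp SX _ _ _ i q11 m1.
(* With no further eigenvalue [lambda k.+1] is 0, and positivity of [x1] suffices. *)
case: (posnP l) => [l0|l0]; first by rewrite (lambda_split_default hX l0).
have [j ->] := lambda_split_attained2 hX l0.
have n0 : (0 < n)%N by rewrite (orth_split_dim q) ltn_addr.
have sig_le : (sigma <= (n%:R * x1 0 i)%:E)%E.
  apply: hsig => // W /hopt[Wp WQ trW].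
  by have := large_eigenvalue_bound hX mu0 Xp Sp SX i QQ Wp WQ trW.
have gam0 : 0 < gamma by rewrite (lt_le_trans _ gam)// powR_gt0.
have [lt_x1 /hdist] := mutilde_lt n0 mu0 c0 gam0 (ltW xi0) sig0 sig_le hmu.
move=> dist_le; apply: le_lt_trans lt_x1; apply: le_trans dist_le.
apply: lb_le_inf; first by case: face0 => Z Zf; exists (fnorm (X - Z)), Z.
move=> _ [Z /sub/hopt[_ ZQ _] <-].
by have := small_eigenvalue_bound hX j ZQ.
Qed.

(** One basis is cut in two ways: [QB] against the rest for [X], and [QN] against the rest for
    [S]. *)
Lemma eigenbasis_blocks_split (R : realType) n nB nT nN (X S : 'M[R]_n)
    (QB : 'M[R]_(n, nB)) (QT : 'M[R]_(n, nT)) (QN : 'M[R]_(n, nN)) :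
  eigenbasis_blocks X S QB QT QN -> exists xB xR sN sR,
  eigen_split X QB (row_mx QT QN) xB xR /\ eigen_split S QN (row_mx QB QT) sN sR.
Proof.
case=> QQ1 QQ [xB [sB [xT [sT [xN [sN [XQ SQ leX leS]]]]]]].
exists xB, (row_mx xT xN), sN, (row_mx sB sT).
have [bb bR Rb RR] : [/\ QB^T *m QB = 1%:M, QB^T *m row_mx QT QN = 0,
    (row_mx QT QN)^T *m QB = 0 & (row_mx QT QN)^T *m row_mx QT QN = 1%:M].
  by move: QQ1; rewrite tr_row_mx mul_col_row scalar_mx_block => /eq_block_mx[].
have [tt tn nt nn] : [/\ QT^T *m QT = 1%:M, QT^T *m QN = 0,
    QN^T *m QT = 0 & QN^T *m QN = 1%:M].
  by move: RR; rewrite tr_row_mx mul_col_row scalar_mx_block => /eq_block_mx[].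
have [bt bn] : QB^T *m QT = 0 /\ QB^T *m QN = 0.
  by move: bR; rewrite mul_mx_row -row_mx0 => /eq_row_mx.
have [tb nb] : QT^T *m QB = 0 /\ QN^T *m QB = 0.
  by move: Rb; rewrite tr_row_mx mul_col_mx -col_mx0 => /eq_col_mx.
have split3 (Y : 'M[R]_n) (yB : 'rV_nB) (yT : 'rV_nT) (yN : 'rV_nN) :
    Y *m row_mx QB (row_mx QT QN) =
      row_mx QB (row_mx QT QN) *m diag_mx (row_mx yB (row_mx yT yN)) ->
    [/\ Y *m QB = QB *m diag_mx yB, Y *m QT = QT *m diag_mx yT
      & Y *m QN = QN *m diag_mx yN].
  rewrite !diag_mx_row !mul_mx_row !mul_row_block !mulmx0 !addr0 !add0r.
  by move=> /eq_row_mx[-> /eq_row_mx[-> ->]].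
have [XB XT XN] := split3 _ _ _ _ XQ; have [SB ST SN] := split3 _ _ _ _ SQ.
have QQ' : QB *m QB^T + (QT *m QT^T + QN *m QN^T) = 1%:M.
  by rewrite -QQ !tr_row_mx !mul_row_col.
split; split.
- by split=> //; rewrite tr_row_mx mul_row_col.
- by [].
- by rewrite mul_mx_row XT XN diag_mx_row mul_row_block !mulmx0 addr0 add0r.
- by [].
- split=> //.
  + by rewrite tr_row_mx mul_col_row bb bt tb tt -scalar_mx_block.
  + by rewrite mul_mx_row nb nt row_mx0.
  + by rewrite tr_row_mx mul_row_col addrC -addrA.
- by [].
- by rewrite mul_mx_row SB ST diag_mx_row mul_row_block !mulmx0 addr0 add0r.
- by [].
Qed.

Lemma tr_psd_comm (R : realType) n (X S : 'M[R]_n) mu :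
  psd X -> psd S -> X *m S = mu%:M -> S *m X = mu%:M.
Proof. by move=> Xp Sp XS; rewrite -{1}Xp.1 -{1}Sp.1 -trmx_mul XS tr_scalar_mx. Qed.

(** * The spectral gap of the unperturbed problem *)

Section GapAtZero.
Variables (R : realType) (n m : nat) (D : sdp R n m).
Hypothesis hD : standing_assumptions D.
Hypothesis mc : max_compl D 0 (mc_sol D 0).
Variables (mu : R) (X : 'M[R]_n) (y : 'cV[R]_m) (S : 'M[R]_n).
Hypotheses (mu0 : 0 < mu) (hc : central D mu 0 X y S).
Variable mt : \bar R.
Hypotheses (hmt : is_mutilde D 0 mt) (mu_lt : (mu%:E < mt)%E).
Variables (k l : nat) (Q1 : 'M[R]_(n, k)) (Q2 : 'M[R]_(n, l)).
Variables (d1 : 'rV[R]_k) (d2 : 'rV[R]_l).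

Let As i : (conA D i)^T = conA D i. Proof. by have [_ _ h] := hD. Qed.
Let Cs : (cost D 0)^T = cost D 0.
Proof. by have [h _ _ _ _] := hD; rewrite /cost scale0r addr0. Qed.
Let Xp : psd X. Proof. by case: hc. Qed.
Let Sp : psd S. Proof. by case: hc. Qed.
Let XS : X *m S = mu%:M. Proof. by case: hc. Qed.
Let SX : S *m X = mu%:M. Proof. exact: tr_psd_comm XS. Qed.
Let fX : primal_feasible D 0 X. Proof. by case: hc. Qed.
Let fS : dual_feasible D 0 y S. Proof. by case: hc. Qed.

Let trSX : inner S X = n%:R * mu.
Proof. by rewrite /inner SX mxtrace_scalar mulr_natl. Qed.

(** An optimal [W] costs no more than [X], and the costs of both exceed the same dual value by their
    inner products with [S]. *)
Let primal_tr W : primal_opt D 0 W -> \tr (W *m S) <= n%:R * mu.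
Proof.
move=> [[Wp AW] Wmin]; rewrite mxtrace_mulC -[leLHS]/(inner S W) -trSX.
have := Wmin _ fX; rewrite (primal_dual_gap fX.2 fS.2) (primal_dual_gap AW fS.2).
by rewrite lerD2l.
Qed.

Let dual_tr z : dual_opt D 0 z -> \tr (z.2 *m X) <= n%:R * mu.
Proof.
move=> [fz zmax]; rewrite -[leLHS]/(inner z.2 X) -trSX.
have := zmax _ _ fS.
have := primal_dual_gap fX.2 fS.2; rewrite (primal_dual_gap fX.2 fz.2); lra.
Qed.

Let mcP : primal_opt D 0 (mc_sol D 0).1. Proof. by case: mc => -[]. Qed.
Let mcD : dual_opt D 0 (mc_sol D 0).2. Proof. by case: mc => _ []. Qed.

(** A relative interior point has the smallest kernel among the optimal solutions, so its range
    supports all of them. *)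
Let primal_supp p (Q0 : 'M[R]_(n, p)) W : orthonormal_basis Q0 (spB D 0) ->
  primal_opt D 0 W -> W *m (Q0 *m Q0^T) = W.
Proof.
move=> hQ hW; apply: orthonormal_supp hQ _ _; first exact: mcP.1.1.1.
have [t t0 ht] := relint_extend mc.1 hW.
by move=> u; exact: psd_extend_ker t0 hW.1.1 ht.1.1.
Qed.

Let dual_supp p (Q0 : 'M[R]_(n, p)) z : orthonormal_basis Q0 (spN D 0) ->
  dual_opt D 0 z -> z.2 *m (Q0 *m Q0^T) = z.2.
Proof.
move=> hQ hz; apply: orthonormal_supp hQ _ _; first exact: mcD.1.1.1.
have [t t0 ht] := relint_extend mc.2 hz.
by move=> u; exact: psd_extend_ker t0 hz.1.1 ht.1.1.
Qed.

Let sigmaB_ge0 p (Q0 : 'M[R]_(n, p)) : (0 <= sigmaB D 0 Q0)%E.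
Proof.
rewrite /sigmaB; case: ifP => // _.
apply: le_trans (ereal_sup_ubound _); last by exists (mc_sol D 0).1; first exact: mcP.
by rewrite lee_fin; have Up := psd_congr Q0 mcP.1.1; exact: (lambda_minP Up.1).2 Up.
Qed.

Let sigmaN_ge0 p (Q0 : 'M[R]_(n, p)) : (0 <= sigmaN D 0 Q0)%E.
Proof.
rewrite /sigmaN; case: ifP => // _.
apply: le_trans (ereal_sup_ubound _); last by exists (mc_sol D 0).2; first exact: mcD.
by rewrite lee_fin; have Up := psd_congr Q0 mcD.1.1; exact: (lambda_minP Up.1).2 Up.
Qed.

Let gap0 Xc yc Sc : primal_opt D 0 Xc -> dual_opt D 0 (yc, Sc) -> inner Sc Xc = 0.
Proof.
have [_ _ _ _ [_ [y0 [S0 [_ fS0 _ pS0]]]]] := hD.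
by move=> hX hS; have := strong_duality As Cs fS0 pS0 hX hS.
Qed.

Lemma primal_spectral_gap : eigen_split X Q1 Q2 d1 d2 -> \rank (spB D 0) = k ->
  (0 < k)%N -> lambda k.+1 X < lambda k X.
Proof.
move=> hX rk k0.
have [kB [kN [QB [QN [Xc [yc [Sc [t1 [t2 [c [gamma]]]]]]]]]]] := hmt.
move=> [[hQB hQN] [hXc hSc] _ [c0 gam hol] mtE].
(* The width of the basis behind the threshold is a priori arbitrary; the rank identifies it with
   the block size. *)
have kE : kB = k by rewrite -rk (orthonormal_basis_rank hQB).
subst kB.
pose face := [set Z : 'M[R]_n | psd Z /\ LbarP D Xc Sc (svec Z)].
apply: (spectral_gap (opt := primal_opt D 0) (face := face)
  (sigma := mine (sigmaB D 0 QB) (sigmaN D 0 QN)) (theta1 := t1) (theta2 := t2)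
  (c := c) (gamma := gamma) hX mu0 Xp Sp SX hQB.1) => //.
- by move=> W hW; split; [exact: hW.1.1|exact: primal_supp hQB hW|exact: primal_tr].
- by move=> Z [Zp]; exact: LbarP_opt hXc hSc Z Zp.
- by exists Xc; split; [exact: hXc.1.1|exact: LbarP_self hXc hSc (gap0 hXc hSc)].
- by rewrite le_min sigmaB_ge0 sigmaN_ge0.
- move=> a _ ha; rewrite ge_min; apply/orP; left.
  rewrite /sigmaB gtn_eqF//; apply: ge_ereal_sup => _ [W hW <-].
  by rewrite lee_fin; exact: ha.
- move=> mu_le; have mu_in : 0 < mu <= muhat n t1 t2 by rewrite mu0 mu_le.
  by have [] := hol _ _ _ _ mu_in hc.
- by rewrite -mtE.
Qed.

(** The primal argument with [X] and [S] exchanged; the optimal set is the projection of the dual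
    one to its slacks. *)
Lemma dual_spectral_gap : eigen_split S Q1 Q2 d1 d2 -> \rank (spN D 0) = k ->
  (0 < k)%N -> lambda k.+1 S < lambda k S.
Proof.
move=> hS rk k0.
have [kB [kN [QB [QN [Xc [yc [Sc [t1 [t2 [c [gamma]]]]]]]]]]] := hmt.
move=> [[hQB hQN] [hXc hSc] _ [c0 gam hol] mtE].
have kE : kN = k by rewrite -rk (orthonormal_basis_rank hQN).
subst kN.
pose face := [set Z : 'M[R]_n | psd Z /\ LbarD D Xc Sc (svec Z)].
apply: (spectral_gap (opt := snd @` dual_opt D 0) (face := face)
  (sigma := mine (sigmaB D 0 QB) (sigmaN D 0 QN)) (theta1 := t1) (theta2 := t2)
  (c := c) (gamma := gamma) hS mu0 Sp Xp XS hQN.1) => //.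
- by move=> _ [z hz <-]; split; [exact: hz.1.1|exact: dual_supp hQN hz|exact: dual_tr].
- by move=> Z [Zp /(LbarD_opt As hXc hSc Zp)[w hw]]; exists (w, Z).
- by exists Sc; split; [exact: hSc.1.1|exact: LbarD_self hXc hSc (gap0 hXc hSc)].
- by rewrite le_min sigmaB_ge0 sigmaN_ge0.
- move=> a _ ha; rewrite ge_min; apply/orP; right.
  rewrite /sigmaN gtn_eqF//; apply: ge_ereal_sup => _ [z hz <-].
  by rewrite lee_fin; apply: ha; exists z.
- move=> mu_le; have mu_in : 0 < mu <= muhat n t1 t2 by rewrite mu0 mu_le.
  by have [] := hol _ _ _ _ mu_in hc.
- by rewrite -mtE.
Qed.

End GapAtZero.

(** * Eigenspaces of the perturbed central solution *)

Theorem theorem4p1 (R : realType) (n m : nat) (D : sdp R n m)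
    (hD : standing_assumptions D)
    (I : set R) (hI : nonlinearity_interval D I) (hI0 : I 0)
    (nB nT nN : nat) (hnB : \rank (spB D 0) = nB)
    (hnT : \rank (spT D 0) = nT) (hnN : \rank (spN D 0) = nN)
    (mu : R) (hmu : 0 < mu)
    (X : 'M[R]_n) (y : 'cV[R]_m) (S : 'M[R]_n)
    (hc : central D mu 0 X y S)
    (eps : R) (hIeps : I eps)
    (Xe : 'M[R]_n) (ye : 'cV[R]_m) (Se : 'M[R]_n)
    (hce : central D mu eps Xe ye Se)
    (mt mte : \bar R) (hmt : is_mutilde D 0 mt) (hmte : is_mutilde D eps mte)
    (hmu_lt : (mu%:E < mine mt mte)%E)
    (hX : fnorm (Xe - X) <= (lambda nB X - lambda nB.+1 X) / 5)
    (hS : fnorm (Se - S) <= (lambda nN S - lambda nN.+1 S) / 5)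
    (QB : 'M[R]_(n, nB)) (QT : 'M[R]_(n, nT)) (QN : 'M[R]_(n, nN))
    (hQ : eigenbasis_blocks X S QB QT QN)
    (QBe : 'M[R]_(n, nB)) (QTe : 'M[R]_(n, nT)) (QNe : 'M[R]_(n, nN))
    (hQe : eigenbasis_blocks Xe Se QBe QTe QNe) :
  (exists (V : 'M[R]_(nT + nN, nB)) (W : 'M[R]_(nB + nT, nN)),
     orthonormal_basis
       ((QB + row_mx QT QN *m V) *m invsqrtmx (1%:M + V^T *m V))
       (colspace QBe) /\
     orthonormal_basis
       ((QN + row_mx QB QT *m W) *m invsqrtmx (1%:M + W^T *m W))
       (colspace QNe)) /\
  subspace_dist (colspace QB) (colspace QBe)
    <= 4 * fnorm (QB^T *m (Xe - X) *m row_mx QT QN)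
       / (lambda nB X - lambda nB.+1 X) /\
  subspace_dist (colspace QN) (colspace QNe)
    <= 4 * fnorm (QN^T *m (Se - S) *m row_mx QB QT)
       / (lambda nN S - lambda nN.+1 S).
Proof.
(* The partition varies on the interval, which forces a maximally complementary solution to exist at
   0. *)
have mc : max_compl D 0 (mc_sol D 0) by exact: max_compl_mc_sol hI.1 hI0.
move: hmu_lt; rewrite lt_min => /andP[mu_mt _].
have [xB [xR [sN [sR [sX sS]]]]] := eigenbasis_blocks_split hQ.
have [xBe [xRe [sNe [sRe [sXe sSe]]]]] := eigenbasis_blocks_split hQe.
(* Below the threshold both gaps at 0 are positive, as the perturbation bounds require. *)
have gapX := primal_spectral_gap hD mc hmu hc hmt mu_mt sX hnB.
have gapS := dual_spectral_gap hD mc hmu hc hmt mu_mt sS hnN.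
have [[V hV] dX] := eigenspace_perturbation sX sXe gapX hX.
have [[W hW] dS] := eigenspace_perturbation sS sSe gapS hS.
by split; [exists V, W|split].
Qed.
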